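(* Let $h_1,h_2,h_3\in\mathbb R$ with $h_1^2\geq h_2^2\geq h_3^2$ and $P>0$. The sum-capacity $C_R$ of the restricted Gaussian Y-channel with gains $h_1,h_2,h_3$ and power $P$ satisfies $$C_R\leq 2C((h_2^2+h_3^2)P).$$
   Context: $C(x)=\frac12\log_2(1+x)$. The restricted (reciprocal) Gaussian Y-channel with real gains $h_1,h_2,h_3$ and power $P>0$: users $1,2,3$ and a relay $r$. For each ordered pair $(j,k)$ of distinct indices in $\{1,2,3\}$, user $j$ holds a message $m_{jk}$, uniform on $\{1,\dots,2^{nR_{jk}}\}$, intended for user $k$; the six messages are mutually independent. Over channel uses $i=1,\dots,n$, the relay receives $Y_{ri}=h_1X_{1i}+h_2X_{2i}+h_3X_{3i}+Z_{ri}$ and user $j$ receives $Y_{ji}=h_jX_{ri}+Z_{ji}$, all noise samples i.i.d. $\mathcal N(0,1)$ independent of the messages. Restricted encoding: $X_j^n=f_j(m_{jk},m_{jl})$ ($\{k,l\}=\{1,2,3\}\setminus\{j\}$); relay $X_{ri}=f_{ri}(Y_r^{i-1})$; power constraints $\frac1n\sum_i\mathbb E[X_{ai}^2]\le P$ for $a\in\{1,2,3,r\}$; user $j$ estimates $(m_{kj},m_{lj})$ from $(Y_j^n,m_{jk},m_{jl})$. A rate tuple is achievable if codes exist whose error probability tends to $0$ as $n\to\infty$; $C_R$ is the supremum of $\sum_{j\ne k}R_{jk}$ over achievable tuples. *)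

(* Defs.v *)
From HB Require Import structures.
From mathcomp Require Import all_boot all_order all_algebra.
From mathcomp Require Import all_classical all_reals all_analysis.
Set Implicit Arguments. Unset Strict Implicit. Unset Printing Implicit Defensive.
Import Order.TTheory GRing.Theory Num.Theory.
Import numFieldNormedType.Exports.
Local Open Scope classical_set_scope.
Local Open Scope ring_scope.

Section YChannel.
Variable R : realType.

Definition Cap (x : R) : R := ln (1 + x) / (2 * ln 2).

Definition gpdf (x : R) : R := expR (- (x ^+ 2) / 2) / Num.sqrt (2 * pi).

(* gint k F = E[F(Z)] where Z_0,...,Z_{k-1} are i.i.d. N(0,1) and Z_i = 0
   for i >= k (iterated Lebesgue integral against the Gaussian density). *)
Fixpoint gint (k : nat) (F : (nat -> R) -> \bar R) : \bar R :=
  match k with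
  | 0 => F (fun _ => 0)
  | k'.+1 => (\int[@lebesgue_measure R]_x
       ((gpdf x)%:E * gint k' (fun z => F (fun i => if i == k' then x else z i))))%E
  end.

(* cylinder sets of R^nat; <<s cyl>> is the product Borel sigma-algebra *)
Definition cyl : set (set (nat -> R)) :=
  [set A | exists (i : nat) (B : set R), measurable B /\ A = (fun z => z i) @^-1` B].

Definition borel_real (F : (nat -> R) -> R) : Prop :=
  forall B : set R, measurable B -> <<s cyl>> (F @^-1` B).

Definition borel_fin (T : Type) (F : (nat -> R) -> T) : Prop :=
  forall w : T, <<s cyl>> (F @^-1` [set w]).

(* users 1,2,3 are indexed 0,1,2; message m_{jk} sits at pair (j,k) *)
Definition pairT := ('I_3 * 'I_3)%type.

(* message-set sizes: |M_{jk}| = ceil(2^{n R_jk}) (dummy 1 on the diagonal) *)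
Definition msize (n : nat) (Rt : pairT -> R) (p : pairT) : nat :=
  if p.1 == p.2 then 1%N else `|Num.ceil (2 `^ (n%:R * Rt p))|%N.

Definition msgs (M : pairT -> nat) := {dffun forall p : pairT, 'I_(M p)}.

Record code (M : pairT -> nat) := Code {
  enc : 'I_3 -> msgs M -> nat -> R;            (* X_{j,t}, t = 0..n-1 *)
  relay : nat -> (nat -> R) -> R;               (* X_{r,t} = relay t (Y_r^{t}) *)
  dec : 'I_3 -> msgs M -> (nat -> R) -> msgs M  (* estimates; entries (k,j) used *)
}.

Section Signals.
Variables (h : 'I_3 -> R) (n : nat) (M : pairT -> nat) (c : code M).

(* truncation: keep the first t samples (causality of the relay) *)
Definition trunc (t : nat) (y : nat -> R) : nat -> R :=
  fun s => if (s < t)%N then y s else 0.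

(* noise layout: z t is Z_{r,t}; z ((j+1) n + t) is Z_{j,t} *)
Definition Yr (m : msgs M) (z : nat -> R) (t : nat) : R :=
  \sum_(j < 3) h j * enc c j m t + z t.

Definition Xr (m : msgs M) (z : nat -> R) (t : nat) : R :=
  relay c t (trunc t (Yr m z)).

Definition Yu (j : 'I_3) (m : msgs M) (z : nat -> R) (t : nat) : R :=
  if (t < n)%N then h j * Xr m z t + z ((j.+1 * n) + t)%N else 0.

Definition err (m : msgs M) (z : nat -> R) : bool :=
  [exists j : 'I_3, exists k : 'I_3,
     (k != j) && (dec c j m (Yu j m z) (k, j) != m (k, j))].

Definition Perr : \bar R :=
  (((#|{: msgs M}|%:R)^-1)%:E *
     \sum_(m : msgs M) gint (4 * n) (fun z => ((err m z)%:R)%:E))%E.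

Definition valid_code (P : R) : Prop :=
  (* restricted encoding: X_j^n depends only on (m_{jk}, m_{jl}) *)
  (forall j (m m' : msgs M), (forall k, k != j -> m (j, k) = m' (j, k)) ->
      enc c j m = enc c j m') /\
  (forall j (m m' : msgs M) y, (forall k, k != j -> m (j, k) = m' (j, k)) ->
      dec c j m y = dec c j m' y) /\
  (forall t, borel_real (relay c t)) /\
  (forall j m, borel_fin (dec c j m)) /\
  (forall j, (n%:R)^-1 * \sum_(t < n)
       ((#|{: msgs M}|%:R)^-1 * \sum_(m : msgs M) (enc c j m t) ^+ 2) <= P) /\
  ((((n%:R)^-1)%:E * \sum_(t < n)
       (((#|{: msgs M}|%:R)^-1)%:E *
          \sum_(m : msgs M) gint (4 * n) (fun z => ((Xr m z t) ^+ 2)%:E)))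
     <= P%:E)%E.

End Signals.

Definition achievable (h : 'I_3 -> R) (P : R) (Rt : pairT -> R) : Prop :=
  (forall p : pairT, p.1 != p.2 -> 0 <= Rt p) /\
  forall eps : R, 0 < eps -> exists N : nat, forall n : nat, (N <= n)%N -> (0 < n)%N ->
    exists c : code (msize n Rt),
      valid_code h n c P /\ (Perr h n c <= eps%:E)%E.

Definition sum_rate (Rt : pairT -> R) : R := \sum_(p : pairT | p.1 != p.2) Rt p.

Definition CR (h : 'I_3 -> R) (P : R) : \bar R :=
  ereal_sup [set (sum_rate Rt)%:E | Rt in achievable h P].

Definition gains (h1 h2 h3 : R) : 'I_3 -> R :=
  fun j => if val j == 0%N then h1 else if val j == 1%N then h2 else h3.

End YChannel.

(* Main.v *)
Require Import Defs.
From HB Require Import structures.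
From mathcomp Require Import all_boot all_order all_algebra.
From mathcomp Require Import all_classical all_reals all_analysis.
From mathcomp Require Import measurable_realfun ring lra zify.
Set Implicit Arguments. Unset Strict Implicit. Unset Printing Implicit Defensive.
Import Order.TTheory GRing.Theory Num.Theory.
Import numFieldNormedType.Exports.
Import HBNNSimple.
Local Open Scope classical_set_scope.
Local Open Scope ring_scope.

(* Change of measure.  Replace the law of a channel output by a Gaussian law q
   that does not depend on the messages, and let rho be the density ratio q/p.
   Under q, a decoder that must name one of K equiprobable messages succeeds
   with probability at most 1/K.  Integrating ln x <= x/2 - 1 + ln 2, taken at
   x = K rho where decoding succeeds and at x = rho where it fails, yields
   (1 - eps) ln K <= E[- ln rho] + ln 2, and for Gaussian q the expectation
   E[- ln rho] only involves second moments, i.e. the power constraints.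

   Uplink: a genie knowing Y_r^n, the noises of the users, m_12, m_13 and m_32
   decodes m_21, m_31 in the role of user 1, and then m_23 in the role of user
   3; having removed X_1, it faces the power (h_2^2 + h_3^2) P.  Downlink: a
   genie knowing Y_2^n, Y_3^n, m_21, m_23 and m_31 decodes m_12, m_32 in the
   role of user 2, and then m_13 in the role of user 3; one input observed
   through the two gains h_2, h_3 again has signal-to-noise ratio
   (h_2^2 + h_3^2) P.  The six rates are thus bounded in two groups of three. *)

(** * The law of the noise *)

Local Notation noise R := (g_sigma_algebraType (@cyl R)).

Section Density.
Context d (T : measurableType d) (R : realType).
Variables (mu nu : {measure set T -> \bar R}) (p : T -> R).
Hypothesis mp : measurable_fun setT p.
Hypothesis p0 : forall x, 0 <= p x.
Hypothesis nuE : forall A, measurable A -> nu A = (\int[mu]_(x in A) (p x)%:E)%E.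
Local Open Scope ereal_scope.

(** Both sides respect monotone limits and nonnegative combinations of indicators, so approximating
    [f] from below by simple functions reduces the identity to [nuE]. *)
Lemma integral_density (f : T -> \bar R) :
  measurable_fun setT f -> (forall x, 0 <= f x) ->
  \int[nu]_x f x = \int[mu]_x ((p x)%:E * f x).
Proof.
move=> mf f0.
pose f_ := nnsfun_approx measurableT mf.
have f_cvg x : (f_ n x)%:E @[n --> \oo] --> f x by apply: cvg_nnsfun_approx.
have f_nd x : {homo (fun n => (f_ n x)%:E) : n m / (n <= m)%N >-> n <= m}.
  by move=> m n mn; rewrite lee_fin; exact/lefP/nd_nnsfun_approx.
have mf_ n : measurable_fun setT (f_ n) by exact: measurable_funP.
transitivity (limn (fun n => \int[nu]_x (f_ n x)%:E)).
  rewrite -monotone_convergence//.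
  - by apply: eq_integral => y _; apply/esym/cvg_lim.
  - by move=> n; exact/measurable_EFinP.
  - by move=> n y _; rewrite lee_fin.
transitivity (limn (fun n => \int[mu]_x ((p x)%:E * (f_ n x)%:E))); last first.
  rewrite -monotone_convergence//.
  - apply: eq_integral => y _; apply/cvg_lim => //.
    by apply: cvgeZl => //; exact: f_cvg.
  - by move=> n; apply: emeasurable_funM; exact/measurable_EFinP.
  - by move=> n y _; rewrite mule_ge0 ?lee_fin.
  - by move=> x _ m n mn; apply: lee_wpmul2l; [rewrite lee_fin | exact: f_nd].
congr (limn _); apply/funext => n.
transitivity (\sum_(k \in range (f_ n))
    \int[mu]_x (k%:E * ((p x)%:E * (\1_(f_ n @^-1` [set k]) x)%:E))).
  under eq_integral do rewrite fimfunE -fsumEFin//.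
  rewrite ge0_integral_fsum//; last 2 first.
  - by move=> y; exact/measurable_EFinP/measurable_funM.
  - by move=> y x _; rewrite nnfun_muleindic_ge0.
  apply: eq_fsbigr => r rr.
  have r0 : (0 <= r)%R.
    by move: rr; rewrite inE => -[x _ <-]; exact: fun_ge0.
  rewrite integralZl_indic_nnsfun// integral_indic// setIT nuE//.
  rewrite ge0_integralZl//=; last 2 first.
  - by apply: emeasurable_funM; exact/measurable_EFinP.
  - by move=> x _; rewrite mule_ge0// lee_fin.
  by congr (_ * _); rewrite integral_mkcond epatch_indic.
rewrite -ge0_integral_fsum//; last 2 first.
- move=> r; apply: emeasurable_funM => //.
  by apply: emeasurable_funM; exact/measurable_EFinP.
- move=> r x _; rewrite muleCA; apply: mule_ge0; first by rewrite lee_fin.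
  by rewrite nnfun_muleindic_ge0.
apply: eq_integral => x _.
rewrite [in RHS]fimfunE -fsumEFin// ge0_mule_fsumr; last first.
  by move=> r; rewrite nnfun_muleindic_ge0.
by apply: eq_fsbigr => r _; rewrite EFinM muleCA.
Qed.

End Density.

Section GaussianMeasure.
Variable R : realType.
Implicit Types (z : noise R) (F : noise R -> \bar R) (k i : nat).

(** Convertible with the update inside [gint], so that unfolding [gint] exposes terms in [upd]. *)
Definition upd (z : nat -> R) (k : nat) (x : R) : nat -> R :=
  fun i => if i == k then x else z i.

Lemma measurable_coord i : measurable_fun setT (fun z : noise R => z i).
Proof.
move=> _ B mB; rewrite setTI; apply: sub_sigma_algebra.
by exists i, B.
Qed.

Lemma measurable_to_noise d (X : measurableType d) (g : X -> noise R) :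
  (forall i, measurable_fun setT (fun x => g x i)) -> measurable_fun setT g.
Proof.
move=> mg; apply: (@measurability _ _ X (noise R) setT g (@cyl R)) => //.
move=> _ [_ [i [B [mB ->]] <-]].
exact: (mg i).
Qed.

Lemma measurable_upd k :
  measurable_fun setT (fun xz : measurableTypeR R * noise R => upd xz.2 k xz.1 : noise R).
Proof.
apply: measurable_to_noise => i; rewrite /upd.
case: (i == k) => /=; first exact: measurable_fst.
exact: (measurableT_comp (measurable_coord i) measurable_snd).
Qed.

Lemma measurable_updl k z : measurable_fun setT (fun x : R => upd z k x : noise R).
Proof.
apply: measurable_to_noise => i; rewrite /upd.
by case: (i == k).
Qed.

Lemma measurable_updr k (x : R) : measurable_fun setT (fun z => upd z k x : noise R).
Proof.
apply: measurable_to_noise => i; rewrite /upd.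
by case: (i == k) => //; exact: measurable_coord.
Qed.

Lemma gpdfE (x : R) : gpdf x = normal_pdf 0 1 x.
Proof.
rewrite normal_pdfE ?oner_eq0// /gpdf /normal_peak /normal_fun subr0.
by rewrite expr1n mul1r mulrC -(mulr_natl pi).
Qed.

Lemma gpdf_ge0 (x : R) : 0 <= gpdf x. Proof. by rewrite gpdfE normal_pdf_ge0. Qed.

Lemma measurable_gpdf : measurable_fun setT (@gpdf R).
Proof.
rewrite (_ : gpdf (R:=R) = normal_pdf 0 1); last by apply/funext => x; exact: gpdfE.
exact: measurable_normal_pdf.
Qed.

Lemma integral_gauss (f : R -> \bar R) :
  measurable_fun setT f -> (forall x, 0 <= f x)%E ->
  (\int[normal_prob 0 1]_x f x = \int[lebesgue_measure]_x ((gpdf x)%:E * f x))%E.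
Proof.
move=> mf f0; apply: integral_density => //.
- exact: measurable_gpdf.
- exact: gpdf_ge0.
- by move=> A mA; apply: eq_integral => x _; rewrite gpdfE.
Qed.

Definition noise_law k (mu : probability (noise R) R) : Prop :=
  forall F, measurable_fun setT F -> (forall z, 0 <= F z)%E ->
  gint k F = (\int[mu]_z F z)%E.

(** Induction on [k]: start from a Dirac mass at the zero sequence, then take the image of the
    product of N(0,1) with the previous law under writing the new sample at index [k]. Tonelli's
    theorem turns integration against it into the iterated integral. *)
Lemma gint_probability k : exists mu, noise_law k mu.
Proof.
elim: k => [|k [mu IH]].
  exists (dirac ((fun=> 0) : noise R)) => F mF F0 /=.
  by rewrite integral_dirac// diracT mul1e.
have mupd := @measurable_upd k.
pose updk (xz : measurableTypeR R * noise R) : noise R := upd xz.2 k xz.1.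
pose nuP : probability (noise R) R :=
  distribution (normal_prob 0 1 \x mu)%E
   (HB.pack_for {mfun _ >-> noise R} updk (isMeasurableFun.Build _ _ _ _ _ mupd)).
exists nuP => F mF F0.
rewrite [RHS](ge0_integral_pushforward mupd)//.
rewrite preimage_setT fubini_tonelli1//=; last exact: measurableT_comp.
rewrite integral_gauss//; last 2 first.
- apply: (measurable_fun_fubini_tonelli_F (F \o updk)) => //.
  exact: measurableT_comp.
  by move=> x; exact: F0.
- by move=> x; apply: integral_ge0 => z _; exact: F0.
apply: eq_integral => x _; congr (_ * _)%E.
rewrite IH//.
exact: (measurableT_comp mF (measurable_updr k x)).
Qed.

(** For [i < k] this is the conditional expectation given all other coordinates. *)
Definition gcoord i (F : noise R -> \bar R) (z : noise R) : \bar R :=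
  (\int[lebesgue_measure]_x ((gpdf x)%:E * F (upd z i x)))%E.

Lemma gcoordE i F z : measurable_fun setT F -> (forall z, 0 <= F z)%E ->
  gcoord i F z = (\int[normal_prob 0 1]_x F (upd z i x))%E.
Proof.
move=> mF F0; rewrite integral_gauss//.
exact: (measurableT_comp mF (measurable_updl i z)).
Qed.

Lemma gcoord_ge0 i F z : (forall z, 0 <= F z)%E -> (0 <= gcoord i F z)%E.
Proof.
move=> F0; apply: integral_ge0 => x _.
by rewrite mule_ge0// lee_fin gpdf_ge0.
Qed.

Lemma measurable_gcoord i F : measurable_fun setT F -> (forall z, 0 <= F z)%E ->
  measurable_fun setT (gcoord i F).
Proof.
move=> mF F0.
rewrite (_ : gcoord i F = fubini_G (normal_prob 0 1)
    (F \o (fun xz : measurableTypeR R * noise R => upd xz.2 i xz.1 : noise R))).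
  apply: measurable_fun_fubini_tonelli_G => /=.
    exact: (measurableT_comp mF (measurable_upd i)).
  by move=> x; exact: F0.
by apply/funext => z; rewrite gcoordE.
Qed.

Lemma integral_gpdf : (\int[lebesgue_measure]_x (@gpdf R x)%:E = 1)%E.
Proof.
rewrite -(integral_normal_pdf (0 : R) 1).
by apply: eq_integral => x _; rewrite gpdfE.
Qed.

Lemma updC z i j (x y : R) : i != j ->
  upd (upd z i x) j y = upd (upd z j y) i x.
Proof.
move=> ij; apply/funext => k; rewrite /upd.
by have [->|//] := eqVneq k j; rewrite eq_sym (negbTE ij).
Qed.

Lemma updU z i (x y : R) : upd (upd z i x) i y = upd z i y.
Proof. by apply/funext => k; rewrite /upd; case: eqP. Qed.

(** By Tonelli's theorem coordinate [i] may be integrated first, with all other coordinates held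
    constant. *)
Lemma gint_gcoord k i F : (i < k)%N ->
  measurable_fun setT F -> (forall z, 0 <= F z)%E ->
  gint k F = gint k (gcoord i F).
Proof.
elim: k F => // k IH F ik mF F0.
have mFk x : measurable_fun setT (fun z : noise R => F (upd z k x)).
  exact: (measurableT_comp mF (measurable_updr k x)).
move: ik; rewrite ltnS leq_eqVlt => /orP[/eqP ->|ik]; last first.
  (* Below the outermost index the two updates commute, and the induction hypothesis applies under
     the integral. *)
  apply: eq_integral => x _; congr (_ * _)%E.
  apply: etrans (IH _ ik (mFk x) (fun=> F0 _)) _.
  congr (gint _ _); apply/funext => z; apply: eq_integral => y _.
  by rewrite updC// ltn_eqF.
have [mu muE] := gint_probability k.
(* For the outermost index, [gcoord k F] is constant in coordinate [k], whose own Gaussian integral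
   then contributes a factor 1. *)
transitivity (\int[mu]_z gcoord k F z)%E; last first.
  transitivity (\int[lebesgue_measure]_x
      ((gpdf x)%:E * gint k (gcoord k F)))%E; last first.
    apply: eq_integral => x _; congr (_ * gint _ _)%E.
    by apply/funext => z; apply: eq_integral => y _;
      exact: (congr1 (fun w => ((gpdf y)%:E * F w)%E) (esym (updU z k x y))).
  rewrite ge0_integralZr//=; last 3 first.
  - by apply/measurable_EFinP; exact: measurable_gpdf.
  - by move=> x _; rewrite lee_fin; exact: gpdf_ge0.
  - rewrite muE//; [|exact: measurable_gcoord|by move=> z; exact: gcoord_ge0].
    by apply: integral_ge0 => z _; exact: gcoord_ge0.
  rewrite integral_gpdf mul1e muE//; first exact: measurable_gcoord.
  by move=> z; exact: gcoord_ge0.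
under [RHS]eq_integral do rewrite gcoordE//.
have := @fubini_tonelli _ _ _ _ _ (normal_prob 0 1) mu
  (F \o (fun xz : measurableTypeR R * noise R => upd xz.2 k xz.1 : noise R))
  (measurableT_comp mF (measurable_upd k)) (fun=> F0 _).
move=> /= <-.
rewrite integral_gauss//; last 2 first.
- apply: (@measurable_fun_fubini_tonelli_F _ _ _ _ _ mu
    (F \o (fun xz : measurableTypeR R * noise R => upd xz.2 k xz.1 : noise R))).
    exact: (measurableT_comp mF (measurable_upd k)).
  by move=> x; exact: F0.
- by move=> x; apply: integral_ge0 => z _; exact: F0.
by apply: eq_integral => x _; rewrite -muE.
Qed.

End GaussianMeasure.

(** * Gaussian integrals on the line *)

Section Gauss1.
Variable R : realType.

(** The image of Lebesgue measure under the affine map, multiplied by [s], gives every half-open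
    interval its length, so it is Lebesgue measure by uniqueness. *)
Lemma integral_affine (s b : R) (f : R -> \bar R) : 0 < s ->
  measurable_fun setT f -> (forall x, 0 <= f x)%E ->
  (\int[lebesgue_measure]_x f x =
   s%:E * \int[lebesgue_measure]_x f (s * x + b)%R)%E.
Proof.
move=> s0 mf f0.
pose phi (x : measurableTypeR R) : measurableTypeR R := s * x + b.
have mphi : measurable_fun setT phi.
  by apply: measurable_funD => //; exact: measurable_funM.
pose pf : {measure set (measurableTypeR R) -> \bar R} :=
  measure_function_pushforward__canonical__measure_function_Measure
    lebesgue_measure mphi.
pose nu : {measure set (measurableTypeR R) -> \bar R} :=
  mscale (NngNum (ltW s0)) pf.
suff H A : measurable A -> lebesgue_measure A = nu A.
  rewrite -(ge0_integral_pushforward mphi lebesgue_measure measurableT)//.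
  rewrite -(ge0_integral_mscale pf measurableT (NngNum (ltW s0)))//.
  by apply: eq_measure_integral => A mA _; exact: H.
apply: lebesgue_measure_unique => _ [[u v]] _ <-.
transitivity (s%:E * lebesgue_measure (phi @^-1` `]u, v]%classic))%E; last by [].
rewrite (_ : _ @^-1` _ = `](u - b) / s, (v - b) / s]%classic); last first.
  apply/seteqP; split => x /=; rewrite !in_itv/= /phi.
    by rewrite ltr_pdivrMr// ler_pdivlMr// ltrBlDr lerBrDr mulrC.
  by rewrite ltr_pdivrMr// ler_pdivlMr// ltrBlDr lerBrDr mulrC.
rewrite !lebesgue_measure_itv/= !lte_fin ltr_pM2r ?invr_gt0// ltrD2r.
case: ifP => _; last by rewrite mule0.
rewrite -!EFinB -EFinM; congr EFin.
by field; rewrite gt_eqF.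
Qed.

Lemma gpdf_scale (u x : R) :
  gpdf x * expR (- ((u ^+ 2 - 1) * x ^+ 2 / 2)) = gpdf (u * x).
Proof.
rewrite /gpdf mulrAC -expRD; congr (expR _ / _).
by field.
Qed.

Lemma measurable_expsq (a : R) :
  measurable_fun setT (fun x : R => (expR (- (a * x ^+ 2 / 2)))%:E).
Proof.
apply/measurable_EFinP; apply: measurableT_comp => //; apply: measurableT_comp => //.
by apply: measurable_funM => //; apply: measurable_funM => //; exact: measurable_funX.
Qed.

Lemma measurable_sqE : measurable_fun setT (fun x : R => (x ^+ 2)%:E).
Proof. by apply/measurable_EFinP; exact: measurable_funX. Qed.

(** Multiplied by the density, the integrand is [gpdf (u * x)], and rescaling by [u] gives back the
    total mass 1. *)
Lemma gauss_exp (u : R) : 0 < u ->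
  (\int[normal_prob 0 1]_x (expR (- ((u ^+ 2 - 1) * x ^+ 2 / 2)))%:E = (u^-1)%:E)%E.
Proof.
move=> u0.
rewrite integral_gauss; [|exact: measurable_expsq|by move=> x; rewrite lee_fin expR_ge0].
have mg : measurable_fun setT (fun x : R => (gpdf x)%:E).
  by apply/measurable_EFinP; exact: measurable_gpdf.
have := integral_affine 0 u0 mg (fun=> gpdf_ge0 _).
rewrite integral_gpdf => H.
transitivity ((u^-1)%:E * (u%:E *
    \int[lebesgue_measure]_x (gpdf (u * x + 0)%R)%:E))%E.
  rewrite muleA -EFinM mulVf ?gt_eqF// mul1e.
  by apply: eq_integral => x _; rewrite -EFinM gpdf_scale addr0.
by rewrite -H mule1.
Qed.

(* Compares expR (- (u^2 - 1) x^2 / 2), whose integral is 1 / u, with its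
   tangent at 0, for u close to 1 from either side. *)
Lemma gauss_second_moment :
  (\int[@normal_prob R 0 1]_x ((x : R) ^+ 2)%:E = 1)%E.
Proof.
set I := (X in X = _).
have I0 : (0 <= I)%E by apply: integral_ge0 => x _; rewrite lee_fin sqr_ge0.
have one : (\int[@normal_prob R 0 1]_x 1 = 1)%E.
  by rewrite integral_cst//= mul1e probability_setT.
have lo (u : R) : 1 < u -> (1 <= (u^-1)%:E + ((u ^+ 2 - 1) / 2)%:E * I)%E.
  move=> u1; have u0 : 0 < u by lra.
  have c0 : 0 <= (u ^+ 2 - 1) / 2 by rewrite divr_ge0// subr_ge0 expr_ge1// ltW.
  rewrite -[X in (X <= _)%E]one -gauss_exp// -ge0_integralZl//; last 2 first.
  - exact: measurable_sqE.
  - by move=> x _; rewrite lee_fin sqr_ge0.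
  rewrite -ge0_integralD//; last 3 first.
  - exact: measurable_expsq.
  - by move=> x _; rewrite -EFinM lee_fin mulr_ge0// sqr_ge0.
  - by apply: emeasurable_funM => //; exact: measurable_sqE.
  apply: ge0_le_integral => //.
  - by apply: emeasurable_funD; [exact: measurable_expsq|
      apply: emeasurable_funM => //; exact: measurable_sqE].
  - move=> x _; rewrite -EFinM -EFinD lee_fin.
    have := expR_ge1Dx (- ((u ^+ 2 - 1) * x ^+ 2 / 2)).
    lra.
have up (u : R) : 0 < u -> u < 1 ->
    (1 + ((1 - u ^+ 2) / 2)%:E * I <= (u^-1)%:E)%E.
  move=> u0 u1.
  have c0 : 0 <= (1 - u ^+ 2) / 2 by rewrite divr_ge0// subr_ge0 expr_le1// ltW.
  rewrite -[X in (X + _)%E]one -gauss_exp// -ge0_integralZl//; last 2 first.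
  - exact: measurable_sqE.
  - by move=> x _; rewrite lee_fin sqr_ge0.
  rewrite -ge0_integralD//; last 2 first.
  - by move=> x _; rewrite -EFinM lee_fin mulr_ge0// sqr_ge0.
  - by apply: emeasurable_funM => //; exact: measurable_sqE.
  apply: ge0_le_integral => //.
  - by move=> x _; rewrite adde_ge0// -EFinM lee_fin mulr_ge0// sqr_ge0.
  - by apply: emeasurable_funD => //; apply: emeasurable_funM => //; exact: measurable_sqE.
  - exact: measurable_expsq.
  - move=> x _; rewrite -EFinM -EFinD lee_fin.
    have := expR_ge1Dx (- ((u ^+ 2 - 1) * x ^+ 2 / 2)).
    lra.
(* An infinite [I] would make the left side of [up] at 1/2 infinite. *)
have : (I != +oo)%E.
  apply/negP => /eqP Ioo.
  have := up (1/2); rewrite Ioo gt0_muley; last by rewrite lte_fin; lra.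
  by rewrite addey// => H; have := H ltac:(lra) ltac:(lra); rewrite leye_eq.
case: I I0 lo up {one} => [r| |]//.
rewrite lee_fin => r0 lo up _; congr EFin.
apply/eqP; rewrite eq_le; apply/andP; split; rewrite leNgt; apply/negP => r1.
(* Multiplied out, [up (1 - d)] reads d (r - 1 - 3/2 d r + d^2 r / 2) <= 0; with d r = (r - 1) / 2
   the bracket is at least (r - 1) / 4. *)
- pose d := (r - 1) / (2 * r).
  have d0 : 0 < d by rewrite divr_gt0//; lra.
  have dr : d * r = (r - 1) / 2.
    by rewrite /d; field; rewrite gt_eqF//; lra.
  have d1 : d < 1 by nra.
  have := up (1 - d) ltac:(lra) ltac:(lra).
  rewrite -EFinM -[X in (X + _ <= _)%E]/(1%:E) -EFinD lee_fin -[X in _ <= X]mul1r.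
  rewrite ler_pdivlMr; last lra.
  nra.
(* The bound [lo w] forces w (w + 1) r >= 2, whereas this [w] has w (w + 1) <= 3 - r, and (3 - r) r
   < 2 for r < 1. *)
- have [w [w1 wr]] : exists w, 1 < w /\ w = 1 + (1 - r) / 4.
    by eexists; split; last reflexivity; lra.
  have := lo w w1; rewrite -EFinM -EFinD lee_fin.
  rewrite -(ler_pM2r (x := w)); last lra.
  rewrite mulrDl mulVf; last by rewrite gt_eqF//; lra.
  move=> H.
  have H2 : 0 <= (w - 1) * (w * (w + 1) * r - 2).
    by rewrite (_ : (w - 1) * _ = 2 * (1 + (w ^+ 2 - 1) / 2 * r * w - 1 * w));
      [lra | field].
  rewrite pmulr_rge0 ?subr_gt0// in H2.
  have H3 : w * (w + 1) * r <= (2 + (1 - r)) * r.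
    by apply: ler_wpM2r => //; rewrite wr; nra.
  nra.
Qed.
End Gauss1.

Section Gauss2.
Variable R : realType.

Lemma integral_opp (f : R -> \bar R) :
  measurable_fun setT f -> (forall x, 0 <= f x)%E ->
  (\int[lebesgue_measure]_x f (- x)%R = \int[lebesgue_measure]_x f x)%E.
Proof.
move=> mf f0.
have mN : measurable_fun setT (-%R : measurableTypeR R -> measurableTypeR R).
  exact: oppr_measurable.
rewrite -(ge0_integral_pushforward mN lebesgue_measure measurableT)//.
by apply: eq_measure_integral => A mA _; exact: lebesgue_measureN.
Qed.

(** The cross term has no constant sign. Adding the integrals for [c] and [- c], equal by symmetry
    of the density, removes it while every integrand stays nonnegative. *)
Lemma gauss_affine_moment (v c : R) :
  (\int[normal_prob 0 1]_x ((v + c * x) ^+ 2)%:E = (v ^+ 2 + c ^+ 2)%:E)%E.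
Proof.
have msq w : measurable_fun setT (fun x : R => ((v + w * x) ^+ 2)%:E).
  apply/measurable_EFinP; apply: measurable_funX; exact: measurable_funD.
have sq0 w (x : R) : (0 <= ((v + w * x) ^+ 2)%:E)%E by rewrite lee_fin sqr_ge0.
pose J w := (\int[normal_prob 0 1]_x ((v + w * x) ^+ 2)%:E)%E.
rewrite -/(J c).
have JN : J (- c) = J c.
  rewrite /J !integral_gauss// -[RHS]integral_opp.
  - apply: eq_integral => x _; rewrite /gpdf sqrrN.
    by congr (_ * (_ ^+ 2)%:E)%E; lra.
  - by apply: emeasurable_funM => //; apply/measurable_EFinP; exact: measurable_gpdf.
  - by move=> x; rewrite mule_ge0// lee_fin gpdf_ge0.
have c20 : 0 <= 2 * c ^+ 2 by rewrite mulr_ge0// sqr_ge0.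
have : (J (- c)%R + J c = (2 * v ^+ 2)%:E +
    (2 * c ^+ 2)%:E * \int[@normal_prob R 0 1]_x ((x : R) ^+ 2)%:E)%E.
  rewrite /J -ge0_integralD//; [|exact: msq|exact: msq].
  have <- : (\int[@normal_prob R 0 1]_x ((2 * c ^+ 2)%:E * ((x : R) ^+ 2)%:E) =
      (2 * c ^+ 2)%:E * \int[@normal_prob R 0 1]_x ((x : R) ^+ 2)%:E)%E.
    rewrite ge0_integralZl//; first exact: measurable_sqE.
    by move=> x _; rewrite lee_fin sqr_ge0.
  have <- : (\int[@normal_prob R 0 1]_x (2 * v ^+ 2)%:E = (2 * v ^+ 2)%:E)%E.
    by rewrite integral_cst//= probability_setT mule1.
  rewrite -ge0_integralD//.
  - apply: eq_integral => x _; rewrite -EFinM -!EFinD; congr EFin.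
    by ring.
  - by move=> x _; rewrite lee_fin mulr_ge0// sqr_ge0.
  - by move=> x _; rewrite -EFinM lee_fin mulr_ge0// sqr_ge0.
  - by apply: emeasurable_funM => //; exact: measurable_sqE.
rewrite gauss_second_moment mule1 JN.
case: (J c) => [r| |]//; rewrite -!EFinD => -[H].
by congr EFin; lra.
Qed.
End Gauss2.

(** * Change of measure along noise coordinates *)

Section NoiseLaw.
Variables (R : realType) (k : nat) (mu : probability (noise R) R).
Hypothesis muE : noise_law k mu.
Implicit Types (z : noise R) (F G : noise R -> \bar R) (i : nat).

Lemma integral_gcoord i F : (i < k)%N ->
  measurable_fun setT F -> (forall z, 0 <= F z)%E ->
  (\int[mu]_z F z = \int[mu]_z gcoord i F z)%E.
Proof.
move=> ik mF F0; rewrite -!muE//.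
- exact: gint_gcoord.
- exact: measurable_gcoord.
- by move=> z; exact: gcoord_ge0.
Qed.

(** By [vi] the value [v z] is a constant while coordinate [i] is integrated, so
    [gauss_affine_moment] applies pointwise. The integral of [v ^+ 2] may be infinite. *)
Lemma integral_sqr_shift i (c : R) (v : noise R -> R) : (i < k)%N ->
  measurable_fun setT v -> (forall z x, v (upd z i x) = v z) ->
  (\int[mu]_z ((v z + c * z i) ^+ 2)%:E = \int[mu]_z (v z ^+ 2)%:E + (c ^+ 2)%:E)%E.
Proof.
move=> ik mv vi.
have mF : measurable_fun setT (fun z => ((v z + c * z i) ^+ 2)%:E).
  apply/measurable_EFinP; apply: measurable_funX; apply: measurable_funD => //.
  by apply: measurable_funM => //; exact: measurable_coord.
have F0 z : (0 <= ((v z + c * z i) ^+ 2)%:E)%E by rewrite lee_fin sqr_ge0.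
rewrite (integral_gcoord ik)//.
have <- : (\int[mu]_z (c ^+ 2)%:E = (c ^+ 2)%:E)%E.
  by rewrite integral_cst//= probability_setT mule1.
rewrite -ge0_integralD//.
- apply: eq_integral => z _; rewrite gcoordE//.
  rewrite -EFinD -gauss_affine_moment; apply: eq_integral => x _.
  by rewrite vi /upd eqxx.
- by move=> z _; rewrite lee_fin sqr_ge0.
- by apply/measurable_EFinP; exact: measurable_funX.
- by move=> z _; rewrite lee_fin sqr_ge0.
Qed.

(* Density at x of N(- a, s^2) divided by that of N(0, 1). *)
Definition lratio (s a x : R) : R :=
  expR (x ^+ 2 / 2 - (x + a) ^+ 2 / (2 * s ^+ 2)) / s.

Lemma lratio_gt0 s a x : 0 < s -> 0 < lratio s a x.
Proof. by move=> s0; rewrite divr_gt0// expR_gt0. Qed.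

(** For s > 0 and Y standard normal, s Y - a has law N(- a, s^2); this is that substitution at the
    level of densities. *)
Lemma gpdf_lratio s a y : s != 0 ->
  s * (gpdf (s * y - a) * lratio s a (s * y - a)) = gpdf y.
Proof.
move=> s0; rewrite /gpdf /lratio.
rewrite subrK mulrACA -expRD.
rewrite [- _ / 2 + _](_ : _ = - y ^+ 2 / 2); last by field.
by field; rewrite s0 gt_eqF// sqrtr_gt0 mulr_gt0// pi_gt0.
Qed.

Lemma lratio_upd s a i z x : lratio s a (upd z i x i) = lratio s a x.
Proof. by rewrite /upd eqxx. Qed.

Lemma measurable_lratio s d (X : measurableType d) (a v : X -> R) :
  measurable_fun setT a -> measurable_fun setT v ->
  measurable_fun setT (fun x => lratio s (a x) (v x)).
Proof.
move=> ma mv; apply: measurable_funM => //; apply: measurableT_comp => //.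
apply: measurable_funB; apply: measurable_funM => //; apply: measurable_funX => //.
exact: measurable_funD.
Qed.

Lemma measurable_affine_upd s i (a : noise R -> R) :
  measurable_fun setT a ->
  measurable_fun setT (fun z => upd z i (s * z i - a z) : noise R).
Proof.
move=> ma; apply: measurable_to_noise => j; rewrite /upd.
case: (j == i); last exact: measurable_coord.
apply: measurable_funB => //; apply: measurable_funM => //.
exact: measurable_coord.
Qed.

(** When coordinate [i] is integrated first, the weight turns its law N(0,1) into N(- a, s^2), the
    law of [s * z i - a z]. By [ai] the shift is constant during that integration. *)
Lemma integral_lratio1 s i (a : noise R -> R) G : 0 < s -> (i < k)%N ->
  measurable_fun setT a -> (forall z x, a (upd z i x) = a z) ->
  measurable_fun setT G -> (forall z, 0 <= G z)%E ->
  (\int[mu]_z (G z * (lratio s (a z) (z i))%:E) =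
   \int[mu]_z G (upd z i (s * z i - a z)%R))%E.
Proof.
move=> s0 ik ma ai mG G0.
have mr : measurable_fun setT (fun z => G z * (lratio s (a z) (z i))%:E)%E.
  apply: emeasurable_funM => //; apply/measurable_EFinP.
  by apply: measurable_lratio => //; exact: measurable_coord.
have r0 z : (0 <= G z * (lratio s (a z) (z i))%:E)%E.
  by rewrite mule_ge0// lee_fin ltW// lratio_gt0.
have mGa := measurableT_comp mG (measurable_affine_upd s i ma).
rewrite (integral_gcoord ik mr r0) (integral_gcoord ik mGa (fun=> G0 _)).
apply: eq_integral => z _; rewrite /gcoord.
have mgz : measurable_fun setT
    (fun x => (gpdf x)%:E * (G (upd z i x) * (lratio s (a z) x)%:E))%E.
  apply: emeasurable_funM; first by apply/measurable_EFinP; exact: measurable_gpdf.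
  apply: emeasurable_funM; first exact: (measurableT_comp mG (measurable_updl i z)).
  by apply/measurable_EFinP; exact: measurable_lratio.
transitivity (\int[lebesgue_measure]_x
    ((gpdf x)%:E * (G (upd z i x) * (lratio s (a z) x)%:E)))%E.
  by apply: eq_integral => x _; rewrite ai lratio_upd.
have g0 x : (0 <= (gpdf x)%:E * (G (upd z i x) * (lratio s (a z) x)%:E))%E.
  apply: mule_ge0; first by rewrite lee_fin gpdf_ge0.
  by apply: mule_ge0; [exact: G0 | rewrite lee_fin ltW// lratio_gt0].
rewrite (integral_affine (- a z) s0 mgz g0).
rewrite -ge0_integralZl.
- apply: eq_integral => x _ /=; have -> : upd z i x i = x by rewrite /upd eqxx.
  rewrite ai updU; move: (G _) => g.
  rewrite -[in RHS](@gpdf_lratio s (a z) x) ?gt_eqF// (muleC g) !muleA -!EFinM.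
  by rewrite -mulrA.
- by [].
- by apply: (measurableT_comp mgz); exact: measurable_funD.
- by move=> x _; exact: g0.
- by rewrite lee_fin ltW.
Qed.

End NoiseLaw.

Section Block.
Variables (R : realType) (k : nat) (mu : probability (noise R) R).
Hypothesis muE : noise_law k mu.
Implicit Types (z w : noise R) (G : noise R -> \bar R).

Definition off_block (b n : nat) (z w : nat -> R) : Prop :=
  forall i, ~~ (b <= i < b + n)%N -> z i = w i.

(** Chosen so that [z (b + t) + a t z], in the applications a channel output with known parts
    removed, becomes [s * z (b + t)] when [a] ignores the block: the dependence on the message
    disappears. *)
Definition shift_block (s : R) (b n : nat) (a : nat -> (nat -> R) -> R)
    (z : nat -> R) : nat -> R :=
  fun i => if (b <= i < b + n)%N then s * z i - a (i - b)%N z else z i.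

Definition lr_block (s : R) (b n : nat) (a : nat -> (nat -> R) -> R)
    (z : nat -> R) : R :=
  \prod_(t < n) lratio s (a t z) (z (b + t)%N).

Lemma lt_off_block b n i : (n <= b)%N -> (i < n)%N -> ~~ (b <= i < b + n)%N.
Proof. by lia. Qed.

Lemma off_block23 n t : (t < n)%N -> ~~ (3 * n <= 2 * n + t < 3 * n + n)%N.
Proof. by lia. Qed.

Lemma off_block32 n t : ~~ (2 * n <= 3 * n + t < 2 * n + n)%N.
Proof. by lia. Qed.

Lemma off_block_upd b n t (z : nat -> R) x : (t < n)%N ->
  off_block b n (upd z (b + t) x) z.
Proof.
by move=> tn i; rewrite /upd; case: eqP => // ->; rewrite leq_addr ltn_add2l tn.
Qed.

Lemma lr_block_gt0 s b n a z : 0 < s -> 0 < lr_block s b n a z.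
Proof. by move=> s0; apply: prodr_gt0 => t _; exact: lratio_gt0. Qed.

Lemma ln_lr_block s b n a z : 0 < s -> ln (lr_block s b n a z) =
  \sum_(t < n) z (b + t)%N ^+ 2 / 2 -
  (\sum_(t < n) (z (b + t)%N + a t z) ^+ 2 / (2 * s ^+ 2) + n%:R * ln s).
Proof.
move=> s0; rewrite /lr_block; elim: n => [|n IH].
  by rewrite !big_ord0 ln1 mul0r; lra.
rewrite !big_ord_recr/= lnM ?posrE ?prodr_gt0 ?lratio_gt0//; last first.
  by move=> t _; exact: lratio_gt0.
rewrite IH ln_div ?posrE ?expR_gt0// expRK -natr1; lra.
Qed.

Lemma measurable_shift_block s b n (a : nat -> noise R -> R) :
  (forall t, measurable_fun setT (a t)) ->
  measurable_fun setT (shift_block s b n a : noise R -> noise R).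
Proof.
move=> ma; apply: measurable_to_noise => i; rewrite /shift_block.
case: (b <= i < b + n)%N; last exact: measurable_coord.
apply: measurable_funB => //; apply: measurable_funM => //.
exact: measurable_coord.
Qed.

Lemma measurable_lr_block s b n (a : nat -> noise R -> R) :
  (forall t, measurable_fun setT (a t)) ->
  measurable_fun setT (lr_block s b n a : noise R -> R).
Proof.
move=> ma; apply: measurable_prod => t _.
by apply: measurable_lratio => //; exact: measurable_coord.
Qed.

Lemma shift_block_off s b n a z : off_block b n (shift_block s b n a z) z.
Proof. by move=> i /negbTE ib; rewrite /shift_block ib. Qed.

(** Induction on the block length, changing the last coordinate first. Since each [a t] ignores the
    whole block, the successive substitutions do not interfere and compose to [shift_block]. *)
Lemma integral_lr_block s b n (a : nat -> noise R -> R) G :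
  0 < s -> (b + n <= k)%N -> (forall t, measurable_fun setT (a t)) ->
  (forall t z w, off_block b n z w -> a t z = a t w) ->
  measurable_fun setT G -> (forall z, 0 <= G z)%E ->
  (\int[mu]_z (G z * (lr_block s b n a z)%:E) =
   \int[mu]_z G (shift_block s b n a z))%E.
Proof.
move=> s0 + ma; elim: n G => [|n IH] G bnk ai mG G0.
  apply: eq_integral => z _; rewrite /lr_block big_ord0 mule1; congr G.
  by apply/funext => i; rewrite /shift_block addn0 ltnNge andbN.
have off_S z w : off_block b n z w -> off_block b n.+1 z w.
  by move=> zw i ib; apply: zw; apply: contra ib; case/andP=> -> /=; lia.
have bi : (b + n < k)%N by lia.
have ain z x : a n (upd z (b + n) x) = a n z.
  by apply: ai => i; rewrite /upd; case: eqP => // ->; rewrite leq_addr/= ltn_add2l ltnSn.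
transitivity (\int[mu]_z ((G z * (lr_block s b n a z)%:E) *
    (lratio s (a n z) (z (b + n)%N))%:E))%E.
  apply: eq_integral => z _.
  by rewrite /lr_block big_ord_recr/= EFinM muleA.
rewrite (integral_lratio1 muE s0 bi (ma n) ain); last 2 first.
- by apply: emeasurable_funM => //; apply/measurable_EFinP; exact: measurable_lr_block.
- by move=> z; rewrite mule_ge0// lee_fin ltW// lr_block_gt0.
transitivity (\int[mu]_z (G (upd z (b + n) (s * z (b + n)%N - a n z)%R) *
   (lr_block s b n a z)%:E))%E.
  apply: eq_integral => z _; congr (_ * (_)%:E)%E.
  rewrite /lr_block; apply: eq_bigr => t _.
  have -> : a t (upd z (b + n) (s * z (b + n)%N - a n z)) = a t z.
    apply: ai => i; rewrite /upd; case: eqP => // ->.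
    by rewrite leq_addr/= ltn_add2l ltnSn.
  by rewrite {1}/upd eqn_add2l ltn_eqF.
rewrite (IH (fun z => G (upd z (b + n) (s * z (b + n)%N - a n z)))).
apply: eq_integral => z _; congr G; apply/funext => i.
rewrite (ai n _ z); last by apply: off_S; exact: shift_block_off.
rewrite /upd /shift_block ltnn andbF addnS ltnS.
have [->|ne] := eqVneq i (b + n)%N; first by rewrite leq_addr leqnn/= addKn.
by rewrite [(i <= _)%N]leq_eqVlt (negbTE ne).
- by lia.
- by move=> t z w zw; apply: ai; exact: off_S.
- exact: (measurableT_comp mG (measurable_affine_upd s (b + n) (ma n))).
- by move=> z; exact: G0.
Qed.

End Block.

(** * The change-of-measure converse in abstract form *)

Lemma sum_converse (R : realType) (I : finType) (x y : R) (a e b g : I -> \bar R) :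
  (forall m, 0 <= e m)%E ->
  (forall m, (x + 1)%:E + a m <= x%:E * e m + b m + g m + y%:E)%E ->
  (\sum_m g m <= #|I|%:R%:E)%E ->
  ((#|I|%:R * x)%:E + \sum_m a m <=
   x%:E * \sum_m e m + \sum_m b m + (#|I|%:R * y)%:E)%E.
Proof.
move=> e0 step sumg.
have := lee_sum (index_enum I) (fun m (_ : true) => step m).
rewrite !big_split/= -ge0_sume_distrr//.
have csum (c : R) : (\sum_(m : I) c%:E = (#|I|%:R * c)%:E)%E.
  by rewrite sumEFin sumr_const mulr_natl.
rewrite !csum => H.
(* The summand 1 of each message adds up to [#|I|], a finite amount that absorbs the total of
   [g]. *)
rewrite -(@leeD2lE _ #|I|%:R%:E)//.
apply: le_trans (le_trans H _).
  by rewrite addeA -EFinD; apply: leeD2r; rewrite lee_fin; lra.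
by rewrite addeAC [leRHS]addeC; apply: leeD.
Qed.

Section Converse.
Context d (T : measurableType d) (R : realType) (mu : probability T R).
Variables (I : finType) (K : R) (ok : I -> T -> bool).
Variables (rho A B : I -> T -> R) (Psi : I -> T -> T).
Hypothesis K1 : 1 <= K.
Hypothesis mok : forall m, measurable_fun setT (fun z => (ok m z)%:R : R).
Hypothesis mrho : forall m, measurable_fun setT (rho m).
Hypothesis mA : forall m, measurable_fun setT (A m).
Hypothesis mB : forall m, measurable_fun setT (B m).
Hypothesis mPsi : forall m, measurable_fun setT (Psi m).
Hypothesis rho0 : forall m z, 0 < rho m z.
Hypothesis A0 : forall m z, 0 <= A m z.
Hypothesis B0 : forall m z, 0 <= B m z.
Hypothesis rhoE : forall m z, ln (rho m z) = A m z - B m z.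
Hypothesis change : forall m G, measurable_fun setT G -> (forall z, 0 <= G z)%E ->
  (\int[mu]_z (G z * (rho m z)%:E) = \int[mu]_z G (Psi m z))%E.
Hypothesis count : forall y, K * \sum_m (ok m (Psi m y))%:R <= #|I|%:R.

(** The tangent of [ln] at 2. This point fits because the weight [1 + K * ok], averaged over the
    messages, has mean at most 2 under the changed law, so that half of it cancels the 1. *)
Lemma ln_half (x : R) : 0 < x -> ln x <= x / 2 - 1 + ln 2.
Proof.
move=> x0; have := @le_ln1Dx R (x / 2 - 1) ltac:(lra).
by rewrite addrC subrK ln_div ?posrE//; lra.
Qed.

Lemma converse_pointwise m z :
  ln K + 1 + A m z <= ln K * (~~ ok m z)%:R + B m z +
     (1 + K * (ok m z)%:R) / 2 * rho m z + ln 2.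
Proof.
have Kp : 0 < K by exact: lt_le_trans K1.
have r0 := rho0 m z; case: (ok m z) => /=; rewrite ?mulr1 ?mulr0.
  have := ln_half (mulr_gt0 Kp r0).
  by rewrite lnM ?posrE// rhoE; lra.
by have := ln_half r0; rewrite rhoE; lra.
Qed.

(** Integrates [converse_pointwise] and sums over messages. With ln rho split as [A - B], the two
    parts stand on opposite sides, so every integrand is nonnegative and no finiteness is required
    yet. *)
Lemma converse :
  ((#|I|%:R * ln K)%:E + \sum_m \int[mu]_z (A m z)%:E <=
   (ln K)%:E * \sum_m \int[mu]_z ((~~ ok m z)%:R)%:E +
   \sum_m \int[mu]_z (B m z)%:E + (#|I|%:R * ln 2)%:E)%E.
Proof.
have lnK0 : 0 <= ln K by exact: ln_ge0.
have ln20 : 0 <= ln 2 :> R by apply: ln_ge0; lra.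
pose g m z : R := (1 + K * (ok m z)%:R) / 2.
have mg m : measurable_fun setT (g m).
  by apply: measurable_funM => //; apply: measurable_funD => //; exact: measurable_funM.
have g0 m z : 0 <= g m z.
  by rewrite divr_ge0// addr_ge0// mulr_ge0// (le_trans ler01).
have mgE m : measurable_fun setT (fun z => (g m z)%:E) by exact/measurable_EFinP.
have g0E m z : (0 <= (g m z)%:E)%E by rewrite lee_fin.
have mnok m : measurable_fun setT (fun z => ((~~ ok m z)%:R : R)).
  rewrite (_ : (fun z => _) = (fun z => 1 - (ok m z)%:R)).
    exact: measurable_funB.
  by apply/funext => z; case: (ok m z) => /=; rewrite ?subrr ?subr0.
have cE (c : R) : (\int[mu]_z c%:E = c%:E)%E.
  by rewrite integral_cst//= probability_setT mule1.
have lhs m : (\int[mu]_z (ln K + 1 + A m z)%:E =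
    (ln K + 1)%:E + \int[mu]_z (A m z)%:E)%E.
  rewrite -(cE (ln K + 1)) -ge0_integralD//.
  - by move=> z _; rewrite lee_fin; lra.
  - by move=> z _; rewrite lee_fin.
  - exact/measurable_EFinP.
have rhs m : (\int[mu]_z (ln K * (~~ ok m z)%:R + B m z + g m z * rho m z + ln 2)%:E =
    (ln K)%:E * \int[mu]_z ((~~ ok m z)%:R)%:E + \int[mu]_z (B m z)%:E +
    \int[mu]_z (g m (Psi m z))%:E + (ln 2)%:E)%E.
  have m1 : measurable_fun setT (fun z => ((ln K)%:E * ((~~ ok m z)%:R)%:E)%E).
    by apply: emeasurable_funM => //; exact/measurable_EFinP.
  have m2 : measurable_fun setT (fun z => (B m z)%:E) by exact/measurable_EFinP.
  have m3 : measurable_fun setT (fun z => ((g m z)%:E * (rho m z)%:E)%E).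
    by apply: emeasurable_funM => //; exact/measurable_EFinP.
  have p1 z : (0 <= (ln K)%:E * ((~~ ok m z)%:R)%:E)%E.
    by rewrite -EFinM lee_fin mulr_ge0.
  have p2 z : (0 <= (B m z)%:E)%E by rewrite lee_fin.
  have p3 z : (0 <= (g m z)%:E * (rho m z)%:E)%E.
    by rewrite -EFinM lee_fin mulr_ge0// ltW.
  rewrite -(cE (ln 2)) -(change m (mgE m) (g0E m)) -ge0_integralZl//; last first.
    exact/measurable_EFinP.
  rewrite -ge0_integralD// -ge0_integralD//; last 2 first.
  - by move=> z _; exact: adde_ge0.
  - exact: emeasurable_funD.
  rewrite -ge0_integralD//.
  - by move=> z _; apply: adde_ge0 => //; exact: adde_ge0.
  - by apply: emeasurable_funD => //; exact: emeasurable_funD.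
have step m : ((ln K + 1)%:E + \int[mu]_z (A m z)%:E <=
    (ln K)%:E * \int[mu]_z ((~~ ok m z)%:R)%:E + \int[mu]_z (B m z)%:E +
    \int[mu]_z (g m (Psi m z))%:E + (ln 2)%:E)%E.
  rewrite -lhs -rhs; apply: ge0_le_integral => //.
  - by move=> z _; rewrite lee_fin addr_ge0// addr_ge0.
  - by apply/measurable_EFinP; exact: measurable_funD.
  - apply/measurable_EFinP; apply: measurable_funD => //.
    apply: measurable_funD; last exact: measurable_funM.
    by apply: measurable_funD => //; exact: measurable_funM.
  - by move=> z _; rewrite lee_fin converse_pointwise.
have sumg : (\sum_m \int[mu]_z (g m (Psi m z))%:E <= #|I|%:R%:E)%E.
  rewrite -ge0_integral_sum//; last first.
    by move=> m; exact: (measurableT_comp (mgE m)).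
  rewrite -(cE #|I|%:R); apply: ge0_le_integral => //.
  - by move=> z _; apply: sume_ge0.
  - by apply: emeasurable_sum => m; exact: (measurableT_comp (mgE m)).
  (* For fixed [z], [count] bounds the sum of the weights by (|I| + |I|) / 2. *)
  - move=> z _; rewrite sumEFin lee_fin -mulr_suml big_split/= sumr_const.
    rewrite -mulr_sumr; have := count z.
    by rewrite -[_ *+ _]mulr_natl mulr1 ler_pdivrMr//; lra.
by apply: sum_converse step sumg => m; apply: integral_ge0 => z _; rewrite lee_fin.
Qed.

(** [al + D] bounds the message average of E[B], so [D] bounds that of E[- ln rho]; finite moments
    allow a return to real numbers and division by [#|I|]. *)
Lemma converse_bound (eps al D : R) (b : I -> R) : (0 < #|I|)%N ->
  (forall m, \int[mu]_z (A m z)%:E = al%:E)%E ->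
  (forall m, \int[mu]_z (B m z)%:E = (b m)%:E)%E ->
  \sum_m b m <= #|I|%:R * (al + D) ->
  (\sum_m \int[mu]_z ((~~ ok m z)%:R)%:E <= (#|I|%:R * eps)%:E)%E ->
  (1 - eps) * ln K <= D + ln 2.
Proof.
move=> I0 intA intB sumb serr.
have lnK0 : 0 <= ln K by exact: ln_ge0.
have N0 : (0 : R) < #|I|%:R by rewrite ltr0n.
have := converse.
under eq_bigr do rewrite intA.
under [X in (_ <= _ + X + _)%E -> _]eq_bigr do rewrite intB.
rewrite !sumEFin sumr_const => H.
have : ((#|I|%:R * ln K)%:E + (al *+ #|I|)%:E <=
    (ln K)%:E * (#|I|%:R * eps)%:E + (\sum_m b m)%:E + (#|I|%:R * ln 2)%:E)%E.
  apply: le_trans H _; apply: leeD => //; apply: leeD => //.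
  by apply: lee_wpmul2l => //; rewrite lee_fin.
rewrite -!EFinM -!EFinD lee_fin -mulr_natl => H1.
rewrite -(ler_pM2l N0).
have -> : #|I|%:R * ((1 - eps) * ln K) = #|I|%:R * ln K - ln K * (#|I|%:R * eps) by ring.
by rewrite mulrDr in sumb *; lra.
Qed.

End Converse.

(** * Counting messages *)

Section Messages.
Variable M : pairT -> nat.
Implicit Types (S W : pred pairT) (m w : msgs M).

Definition merge S m w : msgs M := finfun (fun p => if S p then w p else m p).

Lemma mergeE S m w p : merge S m w p = if S p then w p else m p.
Proof. by rewrite ffunE. Qed.

Lemma card_agree W m :
  #|[pred w : msgs M | [forall p, W p || (w p == m p)]]| = (\prod_(p | W p) M p)%N.
Proof.
have -> : #|[pred w : msgs M | [forall p, W p || (w p == m p)]]| =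
    #|(family (fun p => [pred i : 'I_(M p) | W p || (i == m p)]) :
      simpl_pred {dffun forall p : pairT, 'I_(M p)})|.
  by apply: eq_card => w; rewrite inE; apply: eq_forallb => p.
rewrite card_family foldrE big_image/= [RHS]big_mkcond/=.
apply: eq_bigr => p _; case: (W p) => /=.
  by rewrite -[RHS]card_ord; apply: eq_card.
by apply: etrans (card1 (m p)); apply: eq_card.
Qed.

(** Double counting of pairs (m, w) with m in [H] and w equal to m off [W]: each m has one w for
    every choice of the entries in [W], and by injectivity each w has at most one m. *)
Lemma card_decodable W (H : pred (msgs M)) :
  (forall m m', H m -> H m' -> (forall p, ~~ W p -> m p = m' p) -> m = m') ->
  ((\prod_(p | W p) M p) * #|H| <= #|{: msgs M}|)%N.
Proof.
move=> Hinj.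
rewrite mulnC -sum_nat_const.
under eq_bigr => m _ do rewrite -(card_agree W m) -sum1_card.
rewrite (exchange_big_dep predT)//= -[leqRHS]sum1_card; apply: leq_sum => w _.
rewrite sum1_card; apply/card_le1_eqP => m m' /andP[Hm /forallP wm] /andP[Hm' /forallP wm'].
apply/esym/Hinj => // p /negbTE Wp; have := wm p; have := wm' p.
by rewrite Wp => /= /eqP <- /eqP <-.
Qed.

(** Independence of disjoint groups of uniform entries: swapping the entries in [S] between two
    message tuples is an involution of the pairs, and it turns f(m) g(w) into f(w) g(w). *)
Lemma sum_independent (R : comPzRingType) S (f g : msgs M -> R) :
  (forall m m', (forall p, S p -> m p = m' p) -> f m = f m') ->
  (forall m m', (forall p, ~~ S p -> m p = m' p) -> g m = g m') ->
  #|{: msgs M}|%:R * \sum_m f m * g m = (\sum_m f m) * (\sum_m g m).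
Proof.
move=> fS gS.
pose tau (x : msgs M * msgs M) := (merge S x.1 x.2, merge S x.2 x.1).
have tauK : involutive tau.
  by case=> m w; congr (_, _); apply/ffunP => p; rewrite !mergeE/=; case: (S p).
rewrite mulr_suml.
under [RHS]eq_bigr do rewrite mulr_sumr.
rewrite pair_big/= (reindex_inj (inv_inj tauK))/=.
rewrite mulr_natl -sumr_const.
transitivity (\sum_(x : msgs M * msgs M) f x.2 * g x.2).
  by rewrite -(pair_big predT predT (fun _ m => f m * g m)).
apply: eq_bigr => -[m w] _ /=; congr (_ * _).
  by apply: fS => p Sp; rewrite mergeE Sp.
by apply: gS => p Sp; rewrite mergeE (negbTE Sp).
Qed.

End Messages.

(** * The channel *)

Definition user1 : 'I_3 := Ordinal (isT : (0 < 3)%N).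
Definition user2 : 'I_3 := Ordinal (isT : (1 < 3)%N).
Definition user3 : 'I_3 := Ordinal (isT : (2 < 3)%N).

Lemma sum3 (V : nmodType) (F : 'I_3 -> V) : \sum_(j < 3) F j = F user1 + F user2 + F user3.
Proof.
rewrite !big_ord_recl big_ord0 addr0 addrA.
by congr (F _ + F _ + F _); exact: val_inj.
Qed.

Lemma ord3P (j : 'I_3) : [\/ j = user1, j = user2 | j = user3].
Proof.
by case: j => -[|[|[|//]]] i; [constructor 1|constructor 2|constructor 3]; exact: val_inj.
Qed.

Lemma measurable_indicator d (T : measurableType d) (R : realType) (b : T -> bool) :
  measurable [set z | b z] -> measurable_fun setT (fun z => (b z)%:R : R).
Proof.
move=> mb; rewrite (_ : (fun z => _) = \1_[set z | b z]); first exact: measurable_indic.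
apply/funext => z; rewrite indicE.
by have -> : (z \in [set z | b z]) = b z by apply/idP/idP; rewrite inE.
Qed.

Lemma measurable_existsb d (T : measurableType d) (I : finType) (b : I -> T -> bool) :
  (forall i, measurable [set z | b i z]) -> measurable [set z | [exists i, b i z]].
Proof.
move=> mb.
rewrite (_ : [set z | _] = \big[setU/set0]_(i : I) [set z | b i z]).
  exact: bigsetU_measurable.
rewrite -bigcup_seq; apply/seteqP; split => z /=.
  by move=> /existsP[i bi]; exists i => //=; rewrite mem_index_enum.
by move=> [i _ bi]; apply/existsP; exists i.
Qed.

Section Channel.
Variables (R : realType) (h : 'I_3 -> R) (n : nat) (M : pairT -> nat) (c : Defs.code R M).
Variable P : R.
Hypothesis cP : valid_code h n c P.
Implicit Types (m : msgs M) (j k : 'I_3) (t : nat).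

Let dec_row j m m' y : (forall k, k != j -> m (j, k) = m' (j, k)) ->
  dec c j m y = dec c j m' y.
Proof. by case: cP => _ [+ _]; apply. Qed.

Lemma measurable_relay t : measurable_fun setT (relay c t : noise R -> R).
Proof.
case: cP => _ [_ [mr _]] _ B mB; rewrite setTI; exact: mr.
Qed.

Lemma measurable_Yr m t : measurable_fun setT (fun z : noise R => Yr h c m z t).
Proof. by apply: measurable_funD => //; exact: measurable_coord. Qed.

Lemma measurable_Xr m t : measurable_fun setT (fun z : noise R => Xr h c m z t).
Proof.
apply: (measurableT_comp (measurable_relay t)).
apply: measurable_to_noise => s; rewrite /trunc.
by case: (s < t)%N => //; exact: measurable_Yr.
Qed.

Lemma measurable_Yu j m :
  measurable_fun setT (fun z : noise R => Yu h n c j m z : noise R).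
Proof.
apply: measurable_to_noise => t; rewrite /Yu; case: (t < n)%N => //.
apply: measurable_funD; last exact: measurable_coord.
by apply: measurable_funM => //; exact: measurable_Xr.
Qed.

Lemma measurable_err m : measurable [set z : noise R | err h n c m z].
Proof.
apply: measurable_existsb => j; apply: measurable_existsb => k.
case: (k != j) => /=; last first.
  by rewrite (_ : [set _ : noise R | _] = set0)//; apply/seteqP; split.
(* Measurability of [dec] is given fibre by fibre, so the event is written as a finite union over
   the decoder outputs [w]. *)
rewrite (_ : [set z : noise R | _] = [set z : noise R | [exists w : msgs M,
    (w (k, j) != m (k, j)) && (dec c j m (Yu h n c j m z) == w)]]).
  apply: measurable_existsb => w; case: (_ != _) => /=.
    have := measurable_Yu j m measurableT.
    move=> /(_ [set y | dec c j m y = w]); rewrite setTI => H.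
    rewrite (_ : [set _ : noise R | _] =
        (fun z : noise R => Yu h n c j m z : noise R) @^-1` [set y | dec c j m y = w]).
      by apply: H; case: cP => _ [_ [_ [mdec _]]]; exact: mdec.
    by apply/seteqP; split => z /= /eqP.
  by rewrite (_ : [set _ : noise R | _] = set0)//; apply/seteqP; split.
apply/seteqP; split => z /=.
  by move=> ne; apply/existsP; exists (dec c j m (Yu h n c j m z)); rewrite ne eqxx.
by move=> /existsP[w /andP[wn /eqP ->]].
Qed.

Lemma measurable_ok m : measurable_fun setT (fun z : noise R => (~~ err h n c m z)%:R : R).
Proof.
apply: measurable_indicator.
rewrite (_ : [set _ : noise R | _] = ~` [set z : noise R | err h n c m z]).
  by apply: measurableC; exact: measurable_err.
by apply/seteqP; split => z /= /negP.
Qed.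

(** The decoder receives the same input in both runs, hence returns the same estimates, and both are
    correct. The noises may differ: only the output must be reproduced. *)
Lemma decode_agree j m m' (z z' : nat -> R) :
  ~~ err h n c m z -> ~~ err h n c m' z' ->
  Yu h n c j m z = Yu h n c j m' z' ->
  (forall k, k != j -> m (j, k) = m' (j, k)) ->
  forall k, k != j -> m (k, j) = m' (k, j).
Proof.
have okE w x k : ~~ err h n c w x -> k != j -> dec c j w (Yu h n c j w x) (k, j) = w (k, j).
  by move=> /existsPn/(_ j)/existsPn/(_ k) + kj; rewrite kj negbK => /eqP.
move=> e e' yE row k kj.
by rewrite -(okE _ _ _ e kj) -(okE _ _ _ e' kj) yE (dec_row _ row).
Qed.

End Channel.

(** The uplink set avoids row 1 and the downlink set avoids row 2, so the genie holds all messages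
    of the user decoded first. Each set meets row 3 in one entry, which that user decodes, so that
    user 3 can follow. *)
Definition up_pairs : pred pairT :=
  fun p => [|| p == (user2, user1), p == (user3, user1) | p == (user2, user3)].
Definition down_pairs : pred pairT :=
  fun p => [|| p == (user1, user2), p == (user3, user2) | p == (user1, user3)].

Lemma block0_le n : (0 + n <= 4 * n)%N. Proof. by lia. Qed.
Lemma block2_le n : (2 * n + n <= 4 * n)%N. Proof. by lia. Qed.
Lemma block3_le n : (3 * n + n <= 4 * n)%N. Proof. by lia. Qed.
Lemma leq_mul2n n : (n <= 2 * n)%N. Proof. by lia. Qed.
Lemma leq_mul3n n : (n <= 3 * n)%N. Proof. by lia. Qed.

(** * Rate bounds for a single code *)

Section Bounds.
Variables (R : realType) (h : 'I_3 -> R) (n : nat) (M : pairT -> nat) (c : Defs.code R M).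
Variables (P eps : R) (mu : probability (noise R) R).
Hypothesis n0 : (0 < n)%N.
Hypothesis M0 : forall p, (0 < M p)%N.
Hypothesis P0 : 0 < P.
Hypothesis cP : valid_code h n c P.
Hypothesis ceps : (Perr h n c <= eps%:E)%E.
Hypothesis muE : noise_law (4 * n) mu.
Implicit Types (m : msgs M) (j k : 'I_3) (t : nat).

Let N : R := #|{: msgs M}|%:R.

Lemma card_msgs_gt0 : (0 < #|{: msgs M}|)%N.
Proof. by apply/card_gt0P; exists (finfun (fun p => Ordinal (M0 p))). Qed.

Let N0 : 0 < N. Proof. by rewrite ltr0n card_msgs_gt0. Qed.
Let nR0 : (0 : R) < n%:R. Proof. by rewrite ltr0n. Qed.

Lemma sum_msgs (x : R) : \sum_(m : msgs M) x = N * x.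
Proof. by rewrite sumr_const mulr_natl. Qed.

Lemma sum_err_le :
  (\sum_m \int[mu]_z ((~~ ~~ err h n c m z)%:R)%:E <= (N * eps)%:E)%E.
Proof.
have -> : (\sum_m \int[mu]_z ((~~ ~~ err h n c m z)%:R)%:E =
    \sum_m gint (4 * n) (fun z => ((err h n c m z)%:R)%:E))%E.
  apply: eq_bigr => m _; rewrite muE.
  - by apply: eq_integral => z _; rewrite negbK.
  - apply/measurable_EFinP; apply: measurable_indicator.
    exact: (measurable_err cP).
  - by move=> z; rewrite lee_fin.
have := ceps; rewrite /Perr -/N => H.
have := lee_wpmul2l (ltW N0 : (0 <= N%:E)%E) H.
by rewrite muleA -!EFinM mulfV ?gt_eqF// mul1e.
Qed.

Lemma user_power j : \sum_(t < n) \sum_m enc c j m t ^+ 2 <= n%:R * (N * P).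
Proof.
case: cP => _ [_ [_ [_ [/(_ j) + _]]]].
rewrite -mulr_sumr -/N mulrA -invfM ler_pdivrMl ?mulr_gt0//.
by rewrite mulrA.
Qed.

(** The second moments of [Xr] start as extended reals. They are nonnegative with a finite weighted
    sum, hence all finite, which supplies the real numbers [q]. *)
Lemma relay_power : exists q : msgs M -> nat -> R,
  (forall m t, (t < n)%N -> \int[mu]_z (Xr h c m z t ^+ 2)%:E = (q m t)%:E)%E /\
  \sum_m \sum_(t < n) q m t <= n%:R * (N * P).
Proof.
pose Q m t := (\int[mu]_z (Xr h c m z t ^+ 2)%:E)%E.
have Q0 m t : (0 <= Q m t)%E by apply: integral_ge0 => z _; rewrite lee_fin sqr_ge0.
have QP : (\sum_(t < n) \sum_m Q m t <= (n%:R * (N * P))%:E)%E.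
  case: cP => _ [_ [_ [_ [_ +]]]] => H.
  have {}H : ((n%:R)^-1%:E * \sum_(t < n) (N^-1%:E * \sum_m Q m t) <= P%:E)%E.
    apply: le_trans H; apply: lee_wpmul2l; first by rewrite lee_fin invr_ge0 ltW.
    apply: lee_sum => t _; apply: lee_wpmul2l; first by rewrite lee_fin invr_ge0 ltW.
    apply: lee_sum => m _; rewrite muE//.
      by apply/measurable_EFinP; apply: measurable_funX; exact: (measurable_Xr cP).
    by move=> z; rewrite lee_fin sqr_ge0.
  rewrite -ge0_sume_distrr in H; last by move=> t _; apply: sume_ge0.
  have nN0 : 0 < n%:R * N by rewrite mulr_gt0.
  have := lee_wpmul2l (ltW nN0 : (0 <= (n%:R * N)%:E)%E) H.
  rewrite !muleA -!EFinM.
  have -> : n%:R * N * n%:R^-1 * N^-1 = 1 by field; rewrite !gt_eqF.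
  by rewrite mul1e mulrA.
have Qfin m t : (t < n)%N -> Q m t \is a fin_num.
  move=> tn; rewrite ge0_fin_numE//; apply: le_lt_trans (ltry (n%:R * (N * P))).
  apply: le_trans QP; rewrite (bigD1 (Ordinal tn))//= (bigD1 m)//= -addeA.
  rewrite leeDl//; apply: adde_ge0; first by apply: sume_ge0.
  by apply: sume_ge0 => t' _; apply: sume_ge0.
exists (fun m t => fine (Q m t)); split.
  by move=> m t tn; rewrite fineK// Qfin.
rewrite exchange_big/= -lee_fin -sumEFin.
apply: le_trans QP; apply: lee_sum => t _; rewrite -sumEFin.
by apply: lee_sum => m _; rewrite fineK// Qfin.
Qed.

(** Since [v t] ignores the noise sample added to it, that sample raises the second moment [e t] by
    exactly 1. *)
Lemma integral_sum_sq b s (v : nat -> noise R -> R) (e : nat -> R) :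
  (b + n <= 4 * n)%N -> (forall t, measurable_fun setT (v t)) ->
  (forall t z x, (t < n)%N -> v t (upd z (b + t) x) = v t z) ->
  (forall t, (t < n)%N -> \int[mu]_z (v t z ^+ 2)%:E = (e t)%:E)%E ->
  (\int[mu]_z (\sum_(t < n) (z (b + t)%N + v t z) ^+ 2 / (2 * s ^+ 2))%:E =
    ((\sum_(t < n) e t + n%:R) / (2 * s ^+ 2))%:E)%E.
Proof.
move=> bn mv vi ve.
have s20 : 0 <= (2 * s ^+ 2)^-1 by rewrite invr_ge0 mulr_ge0// sqr_ge0.
have msq (t : nat) : measurable_fun setT
    (fun z : noise R => ((z (b + t)%N + v t z) ^+ 2)%:E).
  apply/measurable_EFinP; apply: measurable_funX; apply: measurable_funD => //.
  exact: measurable_coord.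
transitivity (\int[mu]_z \sum_(t < n)
    ((2 * s ^+ 2)^-1%:E * ((z (b + t)%N + v t z) ^+ 2)%:E))%E.
  by apply: eq_integral => z _; rewrite -sumEFin; apply: eq_bigr => t _; rewrite mulrC EFinM.
rewrite ge0_integral_sum//; last 2 first.
- by move=> t; apply: emeasurable_funM.
- by move=> t z _; rewrite -EFinM lee_fin mulr_ge0// sqr_ge0.
rewrite [RHS](_ : _ = (\sum_(t < n) (2 * s ^+ 2)^-1 * (e t + 1))%:E).
  rewrite -sumEFin; apply: eq_bigr => t _.
  rewrite ge0_integralZl//; last by move=> z _; rewrite lee_fin sqr_ge0.
  rewrite EFinM; congr (_ * _)%E.
  have bt : (b + t < 4 * n)%N by apply: leq_trans bn; rewrite ltn_add2l.
  transitivity (\int[mu]_z ((v t z + 1 * z (b + t)%N) ^+ 2)%:E)%E.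
    by apply: eq_integral => z _; rewrite mul1r addrC.
  rewrite (integral_sqr_shift muE 1 bt)//; last by move=> z x; exact: vi.
  by rewrite ve// expr1n EFinD.
congr EFin; rewrite -mulr_sumr big_split/= sumr_const card_ord.
by rewrite mulrC.
Qed.

Lemma integral_noise_sq b : (b + n <= 4 * n)%N ->
  (\int[mu]_z (\sum_(t < n) z (b + t)%N ^+ 2 / 2)%:E = (n%:R / 2)%:E)%E.
Proof.
move=> bn.
have := @integral_sum_sq b 1 (fun _ _ => 0) (fun=> 0) bn.
rewrite sumr_const mul0rn add0r expr1n mulr1 => <- //.
- by apply: eq_integral => z _; congr EFin; apply: eq_bigr => t _; rewrite addr0.
- move=> t _; rewrite expr0n/= integral_cst//= mul0e.
  by [].
Qed.

Lemma count_decodable W (b : msgs M -> bool) :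
  (forall m m', b m -> b m' -> (forall p, ~~ W p -> m p = m' p) -> m = m') ->
  (\prod_(p | W p) M p)%N%:R * \sum_m (b m)%:R <= N.
Proof.
move=> binj; have := card_decodable binj.
rewrite -(ler_nat R) natrM; apply: le_trans; apply: ler_wpM2l => //.
rewrite -sum1_card natr_sum [leRHS]big_mkcond/=.
by apply: ler_sum => m _; rewrite unfold_in; case: (b m).
Qed.

Lemma prodM_ge1 W : 1 <= (\prod_(p | W p) M p)%N%:R :> R.
Proof. by rewrite ler1n; apply: prodn_gt0. Qed.

Lemma Xr_local m t (z w : nat -> R) :
  (forall s, (s < t)%N -> Yr h c m z s = Yr h c m w s) -> Xr h c m z t = Xr h c m w t.
Proof.
move=> zw; rewrite /Xr; congr (relay c t _); apply/funext => s.
by rewrite /trunc; case: ifP => // /zw.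
Qed.

Lemma integral_addc (f : noise R -> R) (x r : R) :
  measurable_fun setT f -> (forall z, 0 <= f z) -> 0 <= x ->
  (\int[mu]_z (f z)%:E = r%:E)%E -> (\int[mu]_z (f z + x)%:E = (r + x)%:E)%E.
Proof.
move=> mf f0 x0 fr; rewrite EFinD -fr.
have <- : (\int[mu]_z x%:E = x%:E)%E.
  by rewrite integral_cst//= probability_setT mule1.
rewrite -ge0_integralD//.
- by move=> z _; rewrite lee_fin.
- exact/measurable_EFinP.
Qed.

Lemma integral_add (f g : noise R -> R) (r r' : R) :
  measurable_fun setT f -> (forall z, 0 <= f z) ->
  measurable_fun setT g -> (forall z, 0 <= g z) ->
  (\int[mu]_z (f z)%:E = r%:E)%E -> (\int[mu]_z (g z)%:E = r'%:E)%E ->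
  (\int[mu]_z (f z + g z)%:E = (r + r')%:E)%E.
Proof.
move=> mf f0 mg g0 fr gr; rewrite EFinD -fr -gr -ge0_integralD//.
- by move=> z _; rewrite lee_fin.
- exact/measurable_EFinP.
- by move=> z _; rewrite lee_fin.
- exact/measurable_EFinP.
Qed.

Lemma measurable_sum_sq b s (v : nat -> noise R -> R) :
  (forall t, measurable_fun setT (v t)) ->
  measurable_fun setT (fun z : noise R =>
    \sum_(t < n) (z (b + t)%N + v t z) ^+ 2 / (2 * s ^+ 2)).
Proof.
move=> mv; apply: measurable_sum => t; apply: measurable_funM => //.
apply: measurable_funX; apply: measurable_funD => //; exact: measurable_coord.
Qed.

Lemma sum_sq_ge0 b s (v : nat -> noise R -> R) z :
  0 <= \sum_(t < n) (z (b + t)%N + v t z) ^+ 2 / (2 * s ^+ 2).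
Proof. by apply: sumr_ge0 => t _; rewrite divr_ge0 ?sqr_ge0// mulr_ge0// sqr_ge0. Qed.

Lemma measurable_noise_sq b :
  measurable_fun setT (fun z : noise R => \sum_(t < n) z (b + t)%N ^+ 2 / 2).
Proof.
apply: measurable_sum => t; apply: measurable_funM => //.
by apply: measurable_funX; exact: measurable_coord.
Qed.

Lemma noise_sq_ge0 b (z : noise R) : 0 <= \sum_(t < n) z (b + t)%N ^+ 2 / 2.
Proof. by apply: sumr_ge0 => t _; rewrite divr_ge0 ?sqr_ge0. Qed.

(** * The uplink bound *)

(* Centring X_2 alone cancels the cross term E[X_2 X_3], even for codes of
   nonzero mean. *)
Definition up m t : R :=
  h user2 * (enc c user2 m t - N^-1 * \sum_w enc c user2 w t) + h user3 * enc c user3 m t.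

(** The inputs of users 2 and 3 depend on disjoint rows of messages, so the cross sum factors and
    vanishes with its centred factor; centring can only lower the second moment of X_2. *)
Lemma up_power1 t : \sum_m up m t ^+ 2 <=
  h user2 ^+ 2 * \sum_m enc c user2 m t ^+ 2 + h user3 ^+ 2 * \sum_m enc c user3 m t ^+ 2.
Proof.
pose x m := enc c user2 m t; pose y m := enc c user3 m t.
pose xb := N^-1 * \sum_w x w.
have sx : \sum_m x m = N * xb by rewrite /xb mulrA mulfV ?mul1r// gt_eqF.
have sxb : \sum_m (x m - xb) = 0.
  by rewrite sumrB sx sumr_const -mulr_natl -/N subrr.
have cross : \sum_m (x m - xb) * y m = 0.
  have [[encE _] oo] : valid_code h n c P /\ user3 != user2 by split.
  have := @sum_independent M R [pred p | p.1 == user2] (fun m => x m - xb) y.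
  rewrite sxb mul0r => /(_ _ _)/eqP; rewrite mulf_eq0 gt_eqF//= => H.
  apply/eqP/H.
  - move=> m m' mm; rewrite /x (encE user2 m m')// => k _.
    by apply: mm; rewrite /= eqxx.
  - move=> m m' mm; rewrite /y (encE user3 m m')// => k _.
    by apply: mm.
have sq : \sum_m (x m - xb) ^+ 2 = \sum_m x m ^+ 2 - N * xb ^+ 2.
  transitivity (\sum_m (x m ^+ 2 + (- (2 * xb)) * x m + xb ^+ 2)).
    by apply: eq_bigr => m _; ring.
  rewrite !big_split/= -mulr_sumr sx sumr_const -[_ *+ _]mulr_natl -/N; ring.
have -> : \sum_m up m t ^+ 2 = h user2 ^+ 2 * \sum_m (x m - xb) ^+ 2 +
    (2 * h user2 * h user3) * \sum_m (x m - xb) * y m + h user3 ^+ 2 * \sum_m y m ^+ 2.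
  rewrite !mulr_sumr -!big_split/=; apply: eq_bigr => m _.
  by rewrite /up -/(x m) -/(y m) -/xb; ring.
rewrite cross mulr0 addr0 lerD2r sq ler_wpM2l ?sqr_ge0// gerBl.
by rewrite mulr_ge0 ?sqr_ge0// ltW.
Qed.

Lemma up_power : \sum_m \sum_(t < n) up m t ^+ 2 <=
  n%:R * (N * ((h user2 ^+ 2 + h user3 ^+ 2) * P)).
Proof.
rewrite exchange_big/=.
apply: (@le_trans _ _ (\sum_(t < n) (h user2 ^+ 2 * \sum_m enc c user2 m t ^+ 2 +
    h user3 ^+ 2 * \sum_m enc c user3 m t ^+ 2))).
  by apply: ler_sum => t _; exact: up_power1.
rewrite big_split/= -!mulr_sumr.
have := ler_wpM2l (sqr_ge0 (h user2)) (user_power user2).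
have := ler_wpM2l (sqr_ge0 (h user3)) (user_power user3).
lra.
Qed.

Lemma ln_sqrt (x : R) : 0 < x -> ln (Num.sqrt x) = ln x / 2.
Proof.
move=> x0; have s0 : 0 < Num.sqrt x by rewrite sqrtr_gt0.
by rewrite -{2}(sqr_sqrtr (ltW x0)) lnXn// mulr2n; lra.
Qed.

Lemma row_off_pairs (W : pred pairT) j m m' :
  (forall k, ~~ W (j, k)) -> (forall p, ~~ W p -> m p = m' p) ->
  forall k, k != j -> m (j, k) = m' (j, k).
Proof. by move=> Wj agree k _; apply: agree. Qed.

(** The noises [z] and [z'] make [m] and [m'] produce the same relay output once X_1 is removed,
    with the same user noises; the relay then sends the same signal and every user sees the same
    output. *)
Lemma uplink_decodable m m' (z z' : nat -> R) :
  ~~ err h n c m z -> ~~ err h n c m' z' ->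
  (forall t, (t < n)%N -> z t + up m t = z' t + up m' t) ->
  (forall t, (n <= t)%N -> z t = z' t) ->
  (forall p, ~~ up_pairs p -> m p = m' p) -> m = m'.
Proof.
case: cP => encE _ okm okm' zlt zge agree.
have row1 : forall k, k != user1 -> m (user1, k) = m' (user1, k).
  by apply: row_off_pairs agree => k; rewrite /up_pairs !xpair_eqE.
have YrE t : (t < n)%N -> Yr h c m z t = Yr h c m' z' t.
  move=> tn; rewrite /Yr !sum3 (encE _ _ _ row1).
  (* X_1 agrees by [row1], and the mean subtracted in [up] is common to both messages. *)
  by have := zlt t tn; rewrite /up; lra.
have YuE j : Yu h n c j m z = Yu h n c j m' z'.
  apply/funext => t; rewrite /Yu; case: ifP => // tn.
  rewrite (zge (j.+1 * n + t)%N); last by rewrite mulSn -addnA leq_addr.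
  congr (_ * _ + _); rewrite /Xr; congr (relay c t _); apply/funext => i.
  by rewrite /trunc; case: ifP => // it; rewrite YrE// (ltn_trans it).
have dec1 := decode_agree cP okm okm' (YuE user1) row1.
have m31 : m (user3, user1) = m' (user3, user1) by apply: dec1.
have m32 : m (user3, user2) = m' (user3, user2) by apply: agree.
(* Of user 3's own messages, one has just been decoded by user 1 and the other is known to the
   genie. *)
have row3 k : k != user3 -> m (user3, k) = m' (user3, k) by case: (ord3P k) => ->.
have m23 : m (user2, user3) = m' (user2, user3).
  by apply: (decode_agree cP okm okm' (YuE user3) row3).
have m21 : m (user2, user1) = m' (user2, user1) by apply: dec1.
apply/ffunP => p; have [|/agree//] := boolP (up_pairs p).
by rewrite /up_pairs => /or3P[] /eqP ->.
Qed.

(** Under the reference law the samples [z t + up m t] are i.i.d. N(0, s^2), where s^2 = 1 + S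
    bounds their average power. The message average of E[B] then exceeds E[A] = n/2 by at most
    [n * ln s]. *)
Lemma uplink_bound :
  (1 - eps) * ln (\prod_(p | up_pairs p) M p)%N%:R <=
  n%:R * (ln (1 + (h user2 ^+ 2 + h user3 ^+ 2) * P) / 2) + ln 2.
Proof.
set S := (h user2 ^+ 2 + h user3 ^+ 2) * P.
have S0 : 0 <= S by rewrite mulr_ge0 ?addr_ge0 ?sqr_ge0// ltW.
pose s := Num.sqrt (1 + S).
have s2 : s ^+ 2 = 1 + S by rewrite sqr_sqrtr//; lra.
have s1 : 1 <= s by rewrite -sqrtr1 ler_sqrt; lra.
have s0 : 0 < s by apply: lt_le_trans s1.
have lns0 : 0 <= n%:R * ln s by rewrite mulr_ge0 ?ln_ge0// ltW.
rewrite -ln_sqrt; last lra.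
rewrite -/s.
pose a m t (z : noise R) := up m t.
have ma m t : measurable_fun setT (a m t) by exact: measurable_cst.
have bn := block0_le n.
have mB m := measurable_sum_sq 0 s (ma m).
have B0 m := sum_sq_ge0 0 s (a m).
apply: (@converse_bound _ _ _ mu _ _ (fun m z => ~~ err h n c m z)
  (fun m => lr_block s 0 n (a m)) (fun m z => \sum_(t < n) z (0 + t)%N ^+ 2 / 2)
  (fun m z => \sum_(t < n) (z (0 + t)%N + a m t z) ^+ 2 / (2 * s ^+ 2) + n%:R * ln s)
  (fun m => shift_block s 0 n (a m)) (prodM_ge1 _) _ _ _ _ _ _ _ _ _ _ _
  eps (n%:R / 2) (n%:R * ln s)
  (fun m => (\sum_(t < n) up m t ^+ 2 + n%:R) / (2 * s ^+ 2) + n%:R * ln s)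
  card_msgs_gt0 _ _ _ sum_err_le).
- by move=> m; exact: (measurable_ok cP).
- by move=> m; exact: measurable_lr_block.
- by move=> m; exact: measurable_noise_sq.
- by move=> m; apply: measurable_funD.
- by move=> m; exact: measurable_shift_block.
- by move=> m z; exact: lr_block_gt0.
- by move=> m z; exact: noise_sq_ge0.
- by move=> m z; rewrite addr_ge0.
- by move=> m z; rewrite ln_lr_block.
- by move=> m G mG G0; rewrite (integral_lr_block muE).
- move=> y; apply: count_decodable => m m' okm okm' agree.
  (* After the shift the observation is [s * y t] for either message, and the user noises are
     untouched. *)
  apply: (uplink_decodable okm okm' _ _ agree) => t tn.
    by rewrite /shift_block add0n tn /a /= subn0 !subrK.
  by rewrite /shift_block add0n ltnNge tn.
- by move=> m; exact: (integral_noise_sq bn).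
- move=> m; apply: integral_addc => //.
  apply: (@integral_sum_sq 0 s (a m) (fun t => up m t ^+ 2) bn (ma m)) => // t _.
  transitivity (\int[mu]_z cst (up m t ^+ 2)%:E z)%E => //.
  by rewrite integral_cst//= probability_setT mule1.
- rewrite big_split/= sum_msgs -mulr_suml big_split/= sum_msgs s2.
  have S1 : 0 < 1 + S by lra.
  have := up_power; rewrite -/S => H.
  have : (\sum_m \sum_(t < n) up m t ^+ 2 + N * n%:R) / (2 * (1 + S)) <= N * (n%:R / 2).
    by rewrite ler_pdivrMr; [lra | rewrite mulr_gt0].
  lra.
Qed.

(** * The downlink bound *)

(* The reference law of (Y_2, Y_3) is Gaussian with covariance
   1 + P (h_2, h_3)^T (h_2, h_3): Y_2 has variance u, and given Y_2 the output
   Y_3 has mean cc * Y_2 and variance s2^2. *)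
Let u : R := 1 + h user2 ^+ 2 * P.
Let cc : R := h user2 * h user3 * P / u.
Let s1 : R := Num.sqrt u.
Let s2 : R := Num.sqrt ((1 + (h user2 ^+ 2 + h user3 ^+ 2) * P) / u).

Let u1 : 1 <= u. Proof. by rewrite lerDl mulr_ge0 ?sqr_ge0// ltW. Qed.
Let u0 : 0 < u. Proof. exact: lt_le_trans u1. Qed.
Let s1E : s1 ^+ 2 = u. Proof. by rewrite sqr_sqrtr// ltW. Qed.

(** Two forms of the reference variance of Y_3 given Y_2: a quotient of determinants, and the power
    of Y_3 - cc Y_2 = (h_3 - cc h_2) X_r - cc Z_2 + Z_3 at relay power P. *)
Lemma s2E : s2 ^+ 2 = (h user3 - cc * h user2) ^+ 2 * P + cc ^+ 2 + 1.
Proof.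
rewrite sqr_sqrtr; last first.
  rewrite divr_ge0 ?(ltW u0)// addr_ge0// mulr_ge0 ?addr_ge0 ?sqr_ge0//.
  exact: ltW.
rewrite /cc; have := u0; rewrite /u => u0'; field.
by rewrite gt_eqF.
Qed.

Let s2_ge1 : 1 <= s2.
Proof.
have : 1 <= s2 ^+ 2.
  by rewrite s2E lerDr addr_ge0 ?sqr_ge0// mulr_ge0 ?sqr_ge0// ltW.
by rewrite expr_ge1// sqrtr_ge0.
Qed.

Let s1_ge1 : 1 <= s1. Proof. by rewrite -sqrtr1 ler_sqrt// ltW. Qed.
Let s10 : 0 < s1. Proof. exact: lt_le_trans s1_ge1. Qed.
Let s20 : 0 < s2. Proof. exact: lt_le_trans s2_ge1. Qed.

(** [s1 ^+ 2 * s2 ^+ 2] is the determinant of the reference covariance. *)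
Lemma ln_s1s2 : ln s1 + ln s2 = ln (1 + (h user2 ^+ 2 + h user3 ^+ 2) * P) / 2.
Proof.
have S0 : 0 < 1 + (h user2 ^+ 2 + h user3 ^+ 2) * P.
  by rewrite ltr_pwDl// mulr_ge0 ?addr_ge0 ?sqr_ge0// ltW.
by rewrite !ln_sqrt ?divr_gt0// ln_div ?posrE//; lra.
Qed.

Section Downlink.
Variable m : msgs M.

(* Cut off at n: Xr at later times would depend on the noises being shifted. *)
Definition down1 t (z : noise R) : R :=
  if (t < n)%N then h user2 * Xr h c m z t else 0.

(** For [t < n], adding the noise of user 3 gives Y_3 - cc Y_2. The noise of user 2 enters, but that
    of user 3 does not. *)
Definition down2 t (z : noise R) : R :=
  if (t < n)%N then (h user3 - cc * h user2) * Xr h c m z t - cc * z (2 * n + t)%N else 0.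

Definition down_lr (z : noise R) : R :=
  lr_block s1 (2 * n) n down1 z * lr_block s2 (3 * n) n down2 z.

(** The order matters: [down2] must be evaluated at the already shifted noise of user 2. *)
Definition down_shift (z : noise R) : noise R :=
  shift_block s2 (3 * n) n down2 (shift_block s1 (2 * n) n down1 z).

Definition down_noise (z : noise R) : R :=
  \sum_(t < n) z (2 * n + t)%N ^+ 2 / 2 + \sum_(t < n) z (3 * n + t)%N ^+ 2 / 2.

Definition down_signal (z : noise R) : R :=
  \sum_(t < n) (z (2 * n + t)%N + down1 t z) ^+ 2 / (2 * s1 ^+ 2) +
  \sum_(t < n) (z (3 * n + t)%N + down2 t z) ^+ 2 / (2 * s2 ^+ 2) +
  n%:R * (ln s1 + ln s2).

Lemma measurable_down1 t : measurable_fun setT (down1 t).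
Proof.
rewrite /down1; case: (t < n)%N => //.
by apply: measurable_funM => //; exact: (measurable_Xr cP).
Qed.

Lemma measurable_down2 t : measurable_fun setT (down2 t).
Proof.
rewrite /down2; case: (t < n)%N => //.
apply: measurable_funB; apply: measurable_funM => //.
  exact: (measurable_Xr cP).
exact: measurable_coord.
Qed.

Lemma Xr_noise t (z w : noise R) : (t <= n)%N ->
  (forall i, (i < n)%N -> z i = w i) -> Xr h c m z t = Xr h c m w t.
Proof.
by move=> tn zw; apply: Xr_local => i it; rewrite /Yr zw// (leq_trans it).
Qed.

Lemma down1_off b t (z w : noise R) : (n <= b)%N ->
  off_block b n z w -> down1 t z = down1 t w.
Proof.
move=> nb zw; rewrite /down1; case: ifP => // tn; congr (_ * _).
apply: Xr_noise; first exact: ltnW.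
by move=> i i_n; apply: zw; rewrite leqNgt (leq_trans i_n).
Qed.

Lemma down2_off t (z w : noise R) : off_block (3 * n) n z w -> down2 t z = down2 t w.
Proof.
move=> zw; rewrite /down2; case: ifP => // tn; congr (_ * _ - _ * _).
  apply: Xr_noise; first exact: ltnW.
  by move=> i i_n; apply/zw/lt_off_block => //; exact: leq_mul3n.
exact/zw/off_block23.
Qed.

(** Two uses of [integral_lr_block]. The block of user 3 goes first, since its substitution leaves
    the density ratio of user 2's block unchanged. *)
Lemma integral_down_lr (G : noise R -> \bar R) :
  measurable_fun setT G -> (forall z, 0 <= G z)%E ->
  (\int[mu]_z (G z * (down_lr z)%:E) = \int[mu]_z G (down_shift z))%E.
Proof.
move=> mG G0.
have mlr1 := measurable_lr_block s1 (2 * n) n measurable_down1.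
have bn2 := block2_le n; have bn3 := block3_le n.
transitivity (\int[mu]_z ((G z * (lr_block s1 (2 * n) n down1 z)%:E) *
    (lr_block s2 (3 * n) n down2 z)%:E))%E.
  by apply: eq_integral => z _; rewrite /down_lr EFinM muleA.
rewrite (integral_lr_block muE s20 bn3 measurable_down2 down2_off); last 2 first.
- by apply: emeasurable_funM => //; exact/measurable_EFinP.
- by move=> z; rewrite mule_ge0// lee_fin ltW// lr_block_gt0.
have msh := measurable_shift_block s2 (3 * n) n measurable_down2.
pose G2 z := G (shift_block s2 (3 * n) n down2 z).
rewrite -(integral_lr_block (G := G2) muE s10 bn2 measurable_down1); last 3 first.
- by move=> t z w; apply: down1_off; exact: leq_mul2n.
- exact: (measurableT_comp mG msh).
- by move=> z; exact: G0.
apply: eq_integral => z _; congr (_ * _%:E)%E; apply: eq_bigr => t _.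
have off := @shift_block_off R s2 (3 * n) n down2 z.
rewrite (down1_off (b := 3 * n) _ _ off); last exact: leq_mul3n.
by rewrite off// off_block23.
Qed.

Lemma down_noise_integral : (\int[mu]_z (down_noise z)%:E = n%:R%:E)%E.
Proof.
have -> : n%:R = n%:R / 2 + n%:R / 2 :> R by lra.
apply: integral_add.
- exact: measurable_noise_sq.
- by move=> z; exact: noise_sq_ge0.
- exact: measurable_noise_sq.
- by move=> z; exact: noise_sq_ge0.
- by apply: integral_noise_sq; exact: block2_le.
- by apply: integral_noise_sq; exact: block3_le.
Qed.

Lemma down_signal_integral (q : nat -> R) :
  (forall t, (t < n)%N -> \int[mu]_z (Xr h c m z t ^+ 2)%:E = (q t)%:E)%E ->
  (\int[mu]_z (down_signal z)%:E = (
    (\sum_(t < n) h user2 ^+ 2 * q t + n%:R) / (2 * s1 ^+ 2) +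
    (\sum_(t < n) ((h user3 - cc * h user2) ^+ 2 * q t + cc ^+ 2) + n%:R) / (2 * s2 ^+ 2) +
    n%:R * (ln s1 + ln s2))%:E)%E.
Proof.
move=> qE.
have mX t : measurable_fun setT (fun z : noise R => (Xr h c m z t ^+ 2)%:E).
  by apply/measurable_EFinP; apply: measurable_funX; exact: (measurable_Xr cP).
have X0 t (z : noise R) : (0 <= (Xr h c m z t ^+ 2)%:E)%E by rewrite lee_fin sqr_ge0.
have scaleX (x : R) t : (t < n)%N ->
    (\int[mu]_z ((x * Xr h c m z t) ^+ 2)%:E = (x ^+ 2 * q t)%:E)%E.
  move=> tn; rewrite EFinM -qE// -ge0_integralZl//; last by rewrite lee_fin sqr_ge0.
  by apply: eq_integral => z _; rewrite exprMn EFinM.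
have I1 t : (t < n)%N -> (\int[mu]_z (down1 t z ^+ 2)%:E = (h user2 ^+ 2 * q t)%:E)%E.
  by move=> tn; rewrite -scaleX//; apply: eq_integral => z _; rewrite /down1 tn.
have I2 t : (t < n)%N -> (\int[mu]_z (down2 t z ^+ 2)%:E =
    ((h user3 - cc * h user2) ^+ 2 * q t + cc ^+ 2)%:E)%E.
  move=> tn; rewrite EFinD -scaleX// -[in RHS](sqrrN cc).
  have ik : (2 * n + t < 4 * n)%N.
    by apply: leq_trans (block2_le n); rewrite ltn_add2l.
  (* X_r depends on the relay noise only, so user 2's noise is independent of it and adds
     [cc ^+ 2]. *)
  rewrite -(integral_sqr_shift muE (- cc) ik).
  - by apply: eq_integral => z _; rewrite /down2 tn mulNr.
  - by apply: measurable_funM => //; exact: (measurable_Xr cP).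
  - move=> z x; congr (_ * _); apply: Xr_noise; first exact: ltnW.
    move=> i i_n; rewrite /upd ltn_eqF// (leq_trans i_n)//.
    exact: leq_trans (leq_mul2n n) (leq_addr _ _).
have bn2 := block2_le n; have bn3 := block3_le n.
apply: integral_addc.
- by apply: measurable_funD;
    apply: measurable_sum_sq; [exact: measurable_down1 | exact: measurable_down2].
- by move=> z; apply: addr_ge0; exact: sum_sq_ge0.
- by rewrite mulr_ge0// addr_ge0// ln_ge0.
apply: integral_add.
- by apply: measurable_sum_sq; exact: measurable_down1.
- by move=> z; exact: sum_sq_ge0.
- by apply: measurable_sum_sq; exact: measurable_down2.
- by move=> z; exact: sum_sq_ge0.
- apply: (@integral_sum_sq _ _ _ (fun t => h user2 ^+ 2 * q t)
    bn2 measurable_down1) => // t z x tn.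
  by apply: (down1_off (b := 2 * n)); [exact: leq_mul2n | exact: off_block_upd].
- apply: (@integral_sum_sq _ _ _
    (fun t => (h user3 - cc * h user2) ^+ 2 * q t + cc ^+ 2)
    bn3 measurable_down2) => // t z x tn.
  by apply: down2_off; exact: off_block_upd.
Qed.

Lemma ln_down_lr z : ln (down_lr z) = down_noise z - down_signal z.
Proof.
rewrite lnM ?posrE ?lr_block_gt0// !ln_lr_block// /down_noise /down_signal.
lra.
Qed.

Lemma Xr_down_shift t z : (t <= n)%N -> Xr h c m (down_shift z) t = Xr h c m z t.
Proof.
move=> tn; apply: Xr_noise => // i i_n.
rewrite /down_shift !shift_block_off//; apply: lt_off_block => //.
  exact: leq_mul2n.
exact: leq_mul3n.
Qed.

(** No trace of the message or the code remains: this is what makes the observation uninformative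
    under the reference law. *)
Lemma Yu2_down_shift z t : (t < n)%N ->
  Yu h n c user2 m (down_shift z) t = s1 * z (2 * n + t)%N.
Proof.
move=> tn; rewrite /Yu tn Xr_down_shift 1?ltnW//.
rewrite /down_shift shift_block_off; last exact: off_block23.
have -> : (user2.+1 * n + t)%N = (2 * n + t)%N by [].
rewrite /shift_block leq_addr ltn_add2l tn/= addKn /down1 tn.
lra.
Qed.

(** The value is [s2 * z (3 * n + t)] plus [cc] times the output of user 2, the regression of Y_3 on
    Y_2. *)
Lemma Yu3_down_shift z t : (t < n)%N ->
  Yu h n c user3 m (down_shift z) t = s2 * z (3 * n + t)%N + cc * s1 * z (2 * n + t)%N.
Proof.
move=> tn; rewrite /Yu tn Xr_down_shift 1?ltnW//.
have -> : (user3.+1 * n + t)%N = (3 * n + t)%N by [].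
rewrite /down_shift; set w := shift_block s1 _ _ _ _.
have w3 : w (3 * n + t)%N = z (3 * n + t)%N by rewrite /w shift_block_off// off_block32.
have w2 : w (2 * n + t)%N = s1 * z (2 * n + t)%N - h user2 * Xr h c m z t.
  by rewrite /w /shift_block leq_addr ltn_add2l tn/= addKn /down1 tn.
have wX : Xr h c m w t = Xr h c m z t.
  apply: Xr_noise; first exact: ltnW.
  move=> i i_n; rewrite /w shift_block_off// lt_off_block//; exact: leq_mul2n.
rewrite /shift_block leq_addr ltn_add2l tn/= addKn /down2 tn w3 w2 wX.
ring.
Qed.

End Downlink.

Lemma downlink_decodable m m' (z : noise R) :
  ~~ err h n c m (down_shift m z) -> ~~ err h n c m' (down_shift m' z) ->
  (forall p, ~~ down_pairs p -> m p = m' p) -> m = m'.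
Proof.
move=> okm okm' agree.
have row2 : forall k, k != user2 -> m (user2, k) = m' (user2, k).
  by apply: row_off_pairs agree => k; rewrite /down_pairs !xpair_eqE.
have YuE2 : Yu h n c user2 m (down_shift m z) = Yu h n c user2 m' (down_shift m' z).
  apply/funext => t; case: (ltnP t n) => [tn|]; first by rewrite !Yu2_down_shift.
  by rewrite /Yu ltnNge => ->.
have YuE3 : Yu h n c user3 m (down_shift m z) = Yu h n c user3 m' (down_shift m' z).
  apply/funext => t; case: (ltnP t n) => [tn|]; first by rewrite !Yu3_down_shift.
  by rewrite /Yu ltnNge => ->.
have dec2 := decode_agree cP okm okm' YuE2 row2.
have m12 : m (user1, user2) = m' (user1, user2) by apply: dec2.
have m32 : m (user3, user2) = m' (user3, user2) by apply: dec2.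
have m31 : m (user3, user1) = m' (user3, user1) by apply: agree.
(* User 3's message to user 2 has just been decoded by user 2; the genie knows the one to user 1. *)
have row3 k : k != user3 -> m (user3, k) = m' (user3, k) by case: (ord3P k) => ->.
have m13 : m (user1, user3) = m' (user1, user3).
  by apply: (decode_agree cP okm okm' YuE3 row3).
apply/ffunP => p; have [|/agree//] := boolP (down_pairs p).
by rewrite /down_pairs => /or3P[] /eqP ->.
Qed.

Lemma downlink_bound :
  (1 - eps) * ln (\prod_(p | down_pairs p) M p)%N%:R <=
  n%:R * (ln (1 + (h user2 ^+ 2 + h user3 ^+ 2) * P) / 2) + ln 2.
Proof.
have [q [qE qP]] := relay_power.
rewrite -ln_s1s2.
apply: (@converse_bound _ _ _ mu _ _ (fun m z => ~~ err h n c m z)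
  down_lr (fun=> down_noise) down_signal down_shift (prodM_ge1 _) _ _ _ _ _ _ _ _ _ _ _
  eps n%:R (n%:R * (ln s1 + ln s2))
  (fun m => (\sum_(t < n) h user2 ^+ 2 * q m t + n%:R) / (2 * s1 ^+ 2) +
    (\sum_(t < n) ((h user3 - cc * h user2) ^+ 2 * q m t + cc ^+ 2) + n%:R) / (2 * s2 ^+ 2) +
    n%:R * (ln s1 + ln s2))
  card_msgs_gt0 _ _ _ sum_err_le).
- by move=> m; exact: (measurable_ok cP).
- move=> m; apply: measurable_funM; apply: measurable_lr_block.
    exact: measurable_down1.
  exact: measurable_down2.
- by move=> _; apply: measurable_funD; exact: measurable_noise_sq.
- move=> m; apply: measurable_funD => //.
  by apply: measurable_funD; apply: measurable_sum_sq;
    [exact: measurable_down1 | exact: measurable_down2].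
- move=> m; apply: (measurableT_comp (measurable_shift_block _ _ _ (measurable_down2 m))).
  exact: (measurable_shift_block _ _ _ (measurable_down1 m)).
- by move=> m z; rewrite mulr_gt0// lr_block_gt0.
- by move=> _ z; rewrite addr_ge0// noise_sq_ge0.
- move=> m z; apply: addr_ge0; first by apply: addr_ge0; exact: sum_sq_ge0.
  by rewrite mulr_ge0// addr_ge0// ln_ge0.
- by move=> m z; exact: ln_down_lr.
- by move=> m G mG G0; exact: integral_down_lr.
- by move=> y; apply: count_decodable => m m'; exact: downlink_decodable.
- by move=> _; exact: down_noise_integral.
- by move=> m; apply: down_signal_integral; exact: qE.
pose Q := \sum_m \sum_(t < n) q m t.
have Qsum x : \sum_m \sum_(t < n) x * q m t = x * Q.
  by rewrite mulr_sumr; apply: eq_bigr => m _; rewrite mulr_sumr.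
have Csum x : \sum_m \sum_(t < n) (x * q m t + cc ^+ 2) = x * Q + N * (n%:R * cc ^+ 2).
  rewrite -Qsum -sum_msgs -big_split/=; apply: eq_bigr => m _.
  by rewrite big_split/= sumr_const card_ord mulr_natl.
rewrite !big_split/= !sum_msgs -!mulr_suml !big_split/= !sum_msgs Qsum Csum.
have Q1 := ler_wpM2l (sqr_ge0 (h user2)) qP.
have Q2 := ler_wpM2l (sqr_ge0 (h user3 - cc * h user2)) qP.
(* The reference variances are those at full relay power, so each quadratic term averages to at most
   n/2; together they cancel E[A] = n. *)
have b1 : (h user2 ^+ 2 * Q + N * n%:R) / (2 * s1 ^+ 2) <= N * n%:R / 2.
  rewrite ler_pdivrMr ?mulr_gt0 ?exprn_gt0// s1E /u; move: Q1; rewrite -/Q; lra.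
have b2 : ((h user3 - cc * h user2) ^+ 2 * Q + N * (n%:R * cc ^+ 2) + N * n%:R) /
    (2 * s2 ^+ 2) <= N * n%:R / 2.
  rewrite ler_pdivrMr ?mulr_gt0 ?exprn_gt0// s2E; move: Q2; rewrite -/Q; lra.
lra.
Qed.

End Bounds.

(** * The sum rate *)

Lemma msize_gt0 (R : realType) n (Rt : pairT -> R) p : (0 < msize n Rt p)%N.
Proof.
rewrite /msize; case: ifP => // _.
by rewrite absz_gt0 gt_eqF// ceil_gt0 powR_gt0.
Qed.

Lemma ln_msize (R : realType) n (Rt : pairT -> R) p : p.1 != p.2 ->
  n%:R * Rt p * ln 2 <= ln (msize n Rt p)%:R.
Proof.
move=> pp; rewrite -ln_powR ler_ln ?posrE ?powR_gt0 ?ltr0n ?msize_gt0//.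
rewrite /msize (negbTE pp); apply: le_trans (ceil_ge _) _.
by rewrite natr_absz ler_int ler_norm.
Qed.

Lemma ln_prodn (R : realType) (I : finType) (W : pred I) (F : I -> nat) :
  (forall i, (0 < F i)%N) ->
  ln ((\prod_(i | W i) F i)%N%:R : R) = \sum_(i | W i) ln (F i)%:R.
Proof.
move=> F0; suff [] : 0 < (\prod_(i | W i) F i)%N%:R :> R /\
    ln ((\prod_(i | W i) F i)%N%:R : R) = \sum_(i | W i) ln (F i)%:R by [].
rewrite natr_prod; elim/big_rec2 : _ => [|i y x _ [x0 xE]]; first by rewrite ln1.
by rewrite mulr_gt0 ?ltr0n// lnM ?posrE ?ltr0n// xE.
Qed.

Lemma sum_rate_split (R : realType) (Rt : pairT -> R) :
  sum_rate Rt = \sum_(p | up_pairs p) Rt p + \sum_(p | down_pairs p) Rt p.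
Proof.
rewrite /sum_rate (bigID up_pairs)/=; congr (_ + _); apply: eq_bigl => -[i j].
  by case: (ord3P i) => ->; case: (ord3P j) => ->.
by case: (ord3P i) => ->; case: (ord3P j) => ->.
Qed.

(** Divide by [n], let [n] grow, then let [eps] tend to 0. *)
Lemma le_of_linear_bound (R : realType) (a b d : R) : 0 <= a -> 0 <= b ->
  (forall eps, 0 < eps < 1 -> exists N, forall n, (N <= n)%N -> (0 < n)%N ->
     (1 - eps) * (n%:R * a) <= n%:R * b + d) -> a <= b.
Proof.
move=> a0 b0 H; rewrite leNgt; apply/negP => ab.
(* At this [e] at most half of the gap is lost: e a <= (a - b) / 2. *)
pose e := (a - b) / (2 * (a + 1)).
have e0 : 0 < e by rewrite divr_gt0//; lra.
have e1 : e < 1 by rewrite ltr_pdivrMr; lra.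
have [N HN] := H e ltac:(by rewrite e0).
have ea : e * a <= (a - b) / 2.
  rewrite /e mulrAC ler_pdivrMr; last lra.
  nra.
(* From here [n * (a - b) / 2] exceeds [d]; the successor gives the strict inequality and
   [0 < n]. *)
pose n := (maxn N (Num.truncn (2 * `|d| / (a - b)))).+1.
have nN : (N <= n)%N by lia.
have nd : 2 * `|d| / (a - b) < n%:R.
  apply: lt_le_trans (truncnS_gt _) _.
  by rewrite ler_nat ltnS leq_maxr.
rewrite ltr_pdivrMr in nd; last lra.
have := HN n nN isT.
have := ler_norm d.
have n0 : (0 : R) <= n%:R by rewrite ler0n.
have := ler_wpM2l n0 ea.
lra.
Qed.

Theorem theorem6 (R : realType) (h1 h2 h3 P : R) :
  h2 ^+ 2 <= h1 ^+ 2 -> h3 ^+ 2 <= h2 ^+ 2 -> 0 < P ->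
  (CR (gains h1 h2 h3) P <= (2 * Cap ((h2 ^+ 2 + h3 ^+ 2) * P))%:E)%E.
Proof.
move=> _ _ P0; apply: ge_ereal_sup => _ [Rt [Rt0 ach] <-].
rewrite lee_fin.
have ln2 : 0 < ln 2 :> R by apply: ln_gt0; lra.
set L := ln (1 + (h2 ^+ 2 + h3 ^+ 2) * P).
(* Rates are counted in nats from here on: [2 * Cap x] is ln (1 + x) / ln 2. *)
suff : sum_rate Rt * ln 2 <= L.
  by rewrite -ler_pdivlMr// /Cap -/L => /le_trans; apply; rewrite invfM; lra.
have S0 : 0 <= (h2 ^+ 2 + h3 ^+ 2) * P by rewrite mulr_ge0 ?addr_ge0 ?sqr_ge0// ltW.
(* Uplink and downlink each contribute n L / 2 + ln 2. *)
apply: (@le_of_linear_bound _ _ _ (2 * ln 2)).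
- by rewrite mulr_ge0// ?(ltW ln2)//; apply: sumr_ge0 => p /Rt0.
- by rewrite ln_ge0// lerDl.
move=> eps /andP[eps0 eps1].
have [N0 HN] := ach eps eps0; exists N0 => n nN n0.
have [c [cP ceps]] := HN n nN n0.
have [mu muE] := gint_probability R (4 * n).
have M0 := msize_gt0 n Rt.
have up := uplink_bound n0 M0 P0 cP ceps muE.
have down := downlink_bound n0 M0 P0 cP ceps muE.
have rate (W : pred pairT) : (forall p, W p -> p.1 != p.2) ->
    n%:R * ln 2 * \sum_(p | W p) Rt p <= ln (\prod_(p | W p) msize n Rt p)%N%:R.
  move=> Woff; rewrite (ln_prodn _ _ M0) mulr_sumr; apply: ler_sum => p /Woff poff.
  by rewrite mulrAC ln_msize.
have eps10 : 0 <= 1 - eps by lra.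
have /rate ru p : up_pairs p -> p.1 != p.2 by move=> /or3P[] /eqP ->.
have /rate rd p : down_pairs p -> p.1 != p.2 by move=> /or3P[] /eqP ->.
have {}ru := le_trans (ler_wpM2l eps10 ru) up.
have {}rd := le_trans (ler_wpM2l eps10 rd) down.
move: ru rd; rewrite /gains/= -/L sum_rate_split.
lra.
Qed.
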